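(* Let $F$ be a Finsler metric of non-zero isotropic flag curvature $\mathbf K=\mathbf K(x)$ on a manifold $M$. Suppose that the Berwald curvature of $F$ satisfies, on $TM_0$, $$B^i_{\ jkl}=(\mu_jh_{kl}+\mu_kh_{jl}+\mu_lh_{jk})y^i+\lambda\big(h^i_j h_{kl}+h^i_k h_{jl}+h^i_l h_{jk}\big),$$ where $\mu_i=\mu_i(x,y)$ and $\lambda=\lambda(x,y)$ are positively homogeneous in $y$ of degrees $-2$ and $-1$ respectively. Then $F$ is a Riemannian metric if and only if $\mu_i$ is constant along geodesics, i.e. $\mu_{i|m}y^m=0$.
   Context: $M$ is an $n$-dimensional $C^\infty$ manifold and $TM_0=TM\setminus\{0\}$ is the slit tangent bundle, with standard local coordinates $(x^i,y^i)$. A Finsler metric $F:TM\to[0,\infty)$ is $C^\infty$ on $TM_0$, positively 1-homogeneous on fibers, and such that $g_{ij}=\frac12\frac{\partial^2 F^2}{\partial y^i\partial y^j}$ is positive definite on $TM_0$; $F$ is Riemannian if $g_{ij}$ does not depend on $y$. Write $\mathbf g_y(u,v)=g_{ij}(x,y)u^iv^j$. Indices are lowered and raised with $g_{ij}$ and its inverse $g^{ij}$; $y_i=g_{ij}y^j$, $h_{ij}=g_{ij}-F^{-2}y_iy_j$ (angular metric), $h^i_j=\delta^i_j-F^{-2}y^iy_j$. Spray coefficients: $G^i=\frac14 g^{il}\left\{\frac{\partial^2 F^2}{\partial x^k\partial y^l}y^k-\frac{\partial F^2}{\partial x^l}\right\}$; geodesics are the curves $c$ with $\ddot c^i+2G^i(\dot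 c)=0$. Berwald curvature: $B^i_{\ jkl}=\frac{\partial^3G^i}{\partial y^j\partial y^k\partial y^l}$. Riemann curvature $\mathbf R_y:T_xM\to T_xM$: $R^i_{\ k}=2\frac{\partial G^i}{\partial x^k}-y^j\frac{\partial^2G^i}{\partial x^j\partial y^k}+2G^j\frac{\partial^2G^i}{\partial y^j\partial y^k}-\frac{\partial G^i}{\partial y^j}\frac{\partial G^j}{\partial y^k}$. For a flag $P=\mathrm{span}\{y,u\}\subset T_xM$ with flagpole $y$, the flag curvature is $\mathbf K(P,y)=\frac{\mathbf g_y(u,\mathbf R_y(u))}{\mathbf g_y(y,y)\mathbf g_y(u,u)-\mathbf g_y(y,u)^2}$. $F$ has isotropic flag curvature if $\mathbf K(P,y)=\mathbf K(x)$ is a function on $M$ only; ''non-zero'' means $\mathbf K(x)\neq0$ at every $x\in M$. The symbol $|$ denotes the horizontal covariant derivative of the Berwald connection: for a covector field $\mu_i(x,y)$ along $TM_0$, $\mu_{i|m}=\frac{\partial\mu_i}{\partial x^m}-\frac{\partial G^r}{\partial y^m}\frac{\partial\mu_i}{\partial y^r}-\frac{\partial^2G^r}{\partial y^i\partial y^m}\mu_r$. In the assumed form of the Berwald curvature, $\mu_i$ are the components of a covector field along $TM_0$ and $\lambda$ is a scalar function on $TM_0$; since $B^i_{\ jkl}y^j=0$, one has $\mu_iy^i=0$. *)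

(* Defs.v *)
From HB Require Import structures.
From mathcomp Require Import all_boot all_order all_algebra.
From mathcomp Require Import all_classical all_reals all_analysis.

Set Implicit Arguments.
Unset Strict Implicit.
Unset Printing Implicit Defensive.

Import Order.TTheory GRing.Theory Num.Theory.
Import numFieldNormedType.Exports.

Local Open Scope classical_set_scope.
Local Open Scope ring_scope.

Section Smooth.
Context {R : realType} {V W : normedModType R}.

Definition iter_derive (s : seq V) (f : V -> W) : V -> W :=
  foldr (fun v g z => 'D_v g z) f s.

(* For finite-dimensional V and open U this is C^oo on U: differentiability of
   all iterated derivatives contains their continuity. *)
Definition smooth_on (U : set V) (f : V -> W) : Prop :=
  forall s z, U z -> differentiable (iter_derive s f) z.

End Smooth.

Section Differential.
Context {R : numFieldType} {U V W : normedModType R}.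

Lemma near_eq_diff (f g : V -> W) x v :
  differentiable f x -> differentiable g x ->
  (\forall t \near x, f t = g t) -> 'd f x v = 'd g x v.
Proof.
move=> df dg fg.
by rewrite -(deriveE v df) -(deriveE v dg); exact: near_eq_derive.
Qed.

Lemma diff_comp_at (f : U -> V) (g : V -> W) x v :
  differentiable f x -> differentiable g (f x) ->
  'd (g \o f) x v = 'd g (f x) ('d f x v).
Proof. by move=> df dg; rewrite diff_comp. Qed.

Lemma diff_id_at (x v : V) : 'd id x v = v.
Proof. by rewrite (@diff_val _ _ _ _ _ _ _ (is_diff_id x)). Qed.

Lemma diff0 (f : V -> W) x : 'd f x 0 = 0.
Proof. exact: linear0. Qed.

Lemma diff_scale (f : V -> W) x (t : R) v : 'd f x (t *: v) = t *: 'd f x v.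
Proof. exact: linearZ. Qed.

End Differential.

(* A C^oo manifold of dimension n, given by an atlas.  All the conditions below
   are tensorial, so checking them in the charts of one atlas amounts to
   checking them in every chart of the maximal atlas containing it. *)
Record manifold (R : realType) (n : nat) := Manifold {
  point :> topologicalType;
  chart : Type;
  dom : chart -> set point;
  phi : chart -> point -> 'rV[R]_n;
  psi : chart -> 'rV[R]_n -> point;
  manifold_hausdorff : hausdorff_space point;
  manifold_second_countable : @second_countable point;
  dom_cover : forall p, exists a, dom a p;
  dom_open : forall a, open (dom a);
  codom_open : forall a, open (phi a @` dom a);
  phiK : forall a p, dom a p -> psi a (phi a p) = p;
  phi_continuous : forall a p, dom a p -> {for p, continuous (phi a)};
  psi_continuous : forall a x, (phi a @` dom a) x -> {for x, continuous (psi a)};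
  transition_smooth : forall a b,
    smooth_on (phi a @` (dom a `&` dom b)) (phi b \o psi a)
}.

Section TangentBundle.
Context {R : realType} {n : nat} (M : manifold R n).

Definition codom (a : chart M) : set 'rV[R]_n := phi a @` dom a.

Definition transition (a b : chart M) : 'rV[R]_n -> 'rV[R]_n := phi b \o psi a.

(* A tangent vector at p is the family of its coordinate vectors in the charts
   around p, related by the differentials of the changes of coordinates; the
   value 0 in the other charts makes this representation unique. *)
Record tangent_bundle := TangentVector {
  base : M;
  coord : chart M -> 'rV[R]_n;
  coord_change : forall a b, dom a base -> dom b base ->
    coord b = 'd (transition a b) (phi a base) (coord a);
  coord_out : forall a, ~ dom a base -> coord a = 0
}.

Lemma tangent_eq (v w : tangent_bundle) :
  base v = base w -> coord v =1 coord w -> v = w.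
Proof.
case: v w => [p c cc co] [q d dc do_] /= pq /funext cd.
by subst q d; congr TangentVector; exact: Prop_irrelevance.
Qed.

Definition nonzero (v : tangent_bundle) : Prop := exists a, coord v a != 0.

Lemma codom_dom a x : codom a x -> dom a (psi a x).
Proof. by case=> p ap <-; rewrite phiK. Qed.

Lemma codomK a x : codom a x -> phi a (psi a x) = x.
Proof. by case=> p ap <-; rewrite phiK. Qed.

Lemma transition_dom a b x : codom a x -> dom b (psi a x) ->
  (phi a @` (dom a `&` dom b)) x.
Proof.
move=> ax bx; exists (psi a x); last exact: codomK.
by split => //; exact: codom_dom.
Qed.

Lemma transition_differentiable a b x : codom a x -> dom b (psi a x) ->
  differentiable (transition a b) x.
Proof.
by move=> ax bx; apply: (@transition_smooth _ _ M a b [::]); exact: transition_dom.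
Qed.

Lemma transition_near a b x : codom a x -> dom b (psi a x) ->
  \forall t \near x, codom a t /\ dom b (psi a t).
Proof.
move=> ax bx; have A : \forall t \near x, codom a t.
  by apply: open_nbhs_nbhs; split => //; exact: codom_open.
have B : \forall t \near x, dom b (psi a t).
  have psix : psi a @ x --> psi a x by exact: psi_continuous.
  by apply: psix; apply: open_nbhs_nbhs; split => //; exact: dom_open.
by near=> t; split; near: t.
Unshelve. all: by end_near. Qed.

Lemma diff_transition a b c x v :
  codom a x -> dom b (psi a x) -> dom c (psi a x) ->
  'd (transition b c) (transition a b x) ('d (transition a b) x v) =
  'd (transition a c) x v.
Proof.
move=> ax bx cx.
have by_ : codom b (transition a b x) by exists (psi a x).
have psiy : psi b (transition a b x) = psi a x by rewrite /transition /= phiK.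
have dab : differentiable (transition a b) x by exact: transition_differentiable.
have dbc : differentiable (transition b c) (transition a b x).
  by apply: transition_differentiable => //; rewrite psiy.
apply: etrans (esym (@diff_comp_at R _ _ _ _ _ x v dab dbc)) _.
apply: (@near_eq_diff R _ _ _ _ x v).
- exact: differentiable_comp.
- exact: transition_differentiable.
- near=> t; rewrite /transition /= phiK//.
  have : codom a t /\ dom b (psi a t) by near: t; exact: transition_near.
  by case.
Unshelve. all: by end_near. Qed.

Lemma diff_transition_id a x v : codom a x -> 'd (transition a a) x v = v.
Proof.
move=> ax; transitivity ('d (@id 'rV[R]_n) x v); last exact: (@diff_id_at R).
apply: (@near_eq_diff R _ _ _ _ x v).
- by apply: transition_differentiable => //; exact: codom_dom.
- exact: (@ex_diff _ _ _ _ _ _ _ (is_diff_id x)).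
- near=> t; rewrite /transition /= codomK//.
  by near: t; apply: open_nbhs_nbhs; split => //; exact: codom_open.
Unshelve. all: by end_near. Qed.

Definition tvec_coord (a : chart M) (z : 'rV[R]_n * 'rV[R]_n) (b : chart M) :=
  if pselect (codom a z.1 /\ dom b (psi a z.1))
  then 'd (transition a b) (z.1) z.2 else 0.

Lemma tvec_coordE a z b : codom a z.1 -> dom b (psi a z.1) ->
  tvec_coord a z b = 'd (transition a b) (z.1) z.2.
Proof. by move=> az bz; rewrite /tvec_coord; case: pselect => // -[]. Qed.

Lemma tvec_coord0 a z b : ~ (codom a z.1 /\ dom b (psi a z.1)) ->
  tvec_coord a z b = 0.
Proof. by move=> nab; rewrite /tvec_coord; case: pselect. Qed.

Fact tvec_change a z b c : dom b (psi a z.1) -> dom c (psi a z.1) ->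
  tvec_coord a z c =
  'd (transition b c) (phi b (psi a z.1)) (tvec_coord a z b).
Proof.
move=> bz cz; have [az|naz] := pselect (codom a z.1).
  rewrite !tvec_coordE//; apply/esym; exact: diff_transition.
rewrite !tvec_coord0; [|by case..]; apply/esym; exact: (@diff0 R).
Qed.

Fact tvec_out a z b : ~ dom b (psi a z.1) -> tvec_coord a z b = 0.
Proof. by move=> bz; apply: tvec_coord0 => -[]. Qed.

(* The tangent vector y^i d/dx^i at the point of coordinates x in the chart a,
   for z = (x, y); only meaningful for x in codom a. *)
Definition tvec (a : chart M) (z : 'rV[R]_n * 'rV[R]_n) : tangent_bundle :=
  TangentVector (@tvec_change a z) (@tvec_out a z).

Lemma tvecK a z : codom a z.1 -> coord (tvec a z) a = z.2.
Proof.
move=> az; rewrite /= tvec_coordE//; first exact: diff_transition_id.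
exact: codom_dom.
Qed.

Lemma coordK a v : dom a (base v) -> tvec a (phi a (base v), coord v a) = v.
Proof.
move=> av; apply: tangent_eq => [|b] /=; first exact: phiK.
have az : codom a (phi a (base v)) by exists (base v).
have [bv|nbv] := pselect (dom b (base v)).
  by rewrite tvec_coordE ?phiK//; apply/esym/coord_change.
by rewrite (coord_out nbv) tvec_coord0//= phiK// => -[].
Qed.

Fact tscale_change (t : R) v a b : dom a (base v) -> dom b (base v) ->
  t *: coord v b = 'd (transition a b) (phi a (base v)) (t *: coord v a).
Proof.
move=> av bv; rewrite (coord_change av bv).
by apply/esym; exact: (@diff_scale R).
Qed.

Fact tscale_out (t : R) v a : ~ dom a (base v) -> t *: coord v a = 0.
Proof. by move=> av; rewrite coord_out// scaler0. Qed.

Definition tscale (t : R) (v : tangent_bundle) : tangent_bundle :=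
  TangentVector (@tscale_change t v) (@tscale_out t v).

Lemma tscale_tvec t a z : tscale t (tvec a z) = tvec a (z.1, t *: z.2).
Proof.
apply: tangent_eq => //= b.
have [[az bz]|nab] := pselect (codom a z.1 /\ dom b (psi a z.1)).
  by rewrite !tvec_coordE//=; apply/esym; exact: (@diff_scale R).
by rewrite !tvec_coord0// scaler0.
Qed.

(* The part of the domain of the coordinates (x, y) lying in TM_0. *)
Definition slit (a : chart M) : set ('rV[R]_n * 'rV[R]_n) :=
  [set z | codom a z.1 /\ z.2 != 0].

Definition local_rep (f : tangent_bundle -> R) (a : chart M) :
  'rV[R]_n * 'rV[R]_n -> R := f \o tvec a.

(* mu a v is the row of components of the covector mu_v in the chart a. *)
Definition covector_field (mu : chart M -> tangent_bundle -> 'rV[R]_n) : Prop :=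
  forall v a b, nonzero v -> dom a (base v) -> dom b (base v) ->
  forall i, mu a v 0 i =
    \sum_j 'd (transition a b) (phi a (base v)) (delta_mx 0 i) 0 j * mu b v 0 j.

Definition local_cov (mu : chart M -> tangent_bundle -> 'rV[R]_n)
    (a : chart M) (i : 'I_n) : 'rV[R]_n * 'rV[R]_n -> R :=
  fun z => mu a (tvec a z) 0 i.

End TangentBundle.

(* Coordinate expressions at z = (x, y), for L the expression of the Finsler
   metric in a chart. *)
Section LocalExpressions.
Context {R : realType} {n : nat}.
Local Notation V := ('rV[R]_n * 'rV[R]_n)%type.
Local Notation e i := (delta_mx 0 i : 'rV[R]_n).

Definition dx (i : 'I_n) (f : V -> R) : V -> R := fun z => 'D_(e i, 0) f z.
Definition dy (i : 'I_n) (f : V -> R) : V -> R := fun z => 'D_(0, e i) f z.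
Definition yc (i : 'I_n) : V -> R := fun z => z.2 0 i.

Variable L : V -> R.

Definition L2 : V -> R := fun z => L z ^+ 2.

Definition gmx (z : V) : 'M[R]_n := \matrix_(i, j) (2^-1 * dy i (dy j L2) z).

Definition inner (z : V) (u v : 'rV[R]_n) : R :=
  \sum_i \sum_j gmx z i j * u 0 i * v 0 j.

Definition y_low (i : 'I_n) (z : V) : R := \sum_j gmx z i j * yc j z.

Definition h_low (i j : 'I_n) (z : V) : R :=
  gmx z i j - (L z)^-2 * y_low i z * y_low j z.

Definition h_mix (i j : 'I_n) (z : V) : R :=
  (i == j)%:R - (L z)^-2 * yc i z * y_low j z.

Definition spray (i : 'I_n) : V -> R := fun z =>
  4^-1 * \sum_l invmx (gmx z) i l *
    (\sum_k dx k (dy l L2) z * yc k z - dx l L2 z).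

Definition berwald (i j k l : 'I_n) : V -> R := dy j (dy k (dy l (spray i))).

Definition riemann (i k : 'I_n) : V -> R := fun z =>
  2 * dx k (spray i) z
  - \sum_j yc j z * dx j (dy k (spray i)) z
  + 2 * \sum_j spray j z * dy j (dy k (spray i)) z
  - \sum_j dy j (spray i) z * dy k (spray j) z.

Definition riemann_op (z : V) (u : 'rV[R]_n) : 'rV[R]_n :=
  \row_i \sum_k riemann i k z * u 0 k.

(* The flag is span{y, u}, with flagpole y. *)
Definition flag_curvature (z : V) (u : 'rV[R]_n) : R :=
  inner z u (riemann_op z u) /
  (inner z z.2 z.2 * inner z u u - inner z z.2 u ^+ 2).

(* mu_{i|m} *)
Definition hcov (mu : 'I_n -> V -> R) (i m : 'I_n) : V -> R := fun z =>
  dx m (mu i) z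
  - \sum_r dy m (spray r) z * dy r (mu i) z
  - \sum_r dy i (dy m (spray r)) z * mu r z.

End LocalExpressions.

Section Finsler.
Context {R : realType} {n : nat} {M : manifold R n}.
Implicit Type F : tangent_bundle M -> R.

Record finsler_metric F : Prop := FinslerMetric {
  finsler_ge0 : forall v, 0 <= F v;
  finsler_smooth : forall a, smooth_on (slit a) (local_rep F a);
  finsler_homogeneous : forall t v, 0 < t -> F (tscale t v) = t * F v;
  finsler_posdef : forall a z, slit a z ->
    forall u, u != 0 -> 0 < inner (local_rep F a) z u u
}.

Definition riemannian F : Prop :=
  forall a x y y', slit a (x, y) -> slit a (x, y') ->
  gmx (local_rep F a) (x, y) = gmx (local_rep F a) (x, y').

Definition isotropic_flag_curvature F (K : M -> R) : Prop :=
  forall a z u, slit a z -> free [:: z.2; u] ->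
  flag_curvature (local_rep F a) z u = K (psi a z.1).

Definition constant_along_geodesics F
    (mu : chart M -> tangent_bundle M -> 'rV[R]_n) : Prop :=
  forall a z, slit a z -> forall i,
  \sum_m hcov (local_rep F a) (local_cov mu a) i m z * yc m z = 0.

End Finsler.

(* Main.v *)
Require Import Defs.
From HB Require Import structures.
From mathcomp Require Import all_boot all_order all_algebra ring lra.
From mathcomp Require Import all_classical all_reals all_analysis.
Import Order.TTheory GRing.Theory Num.Theory.
Import numFieldNormedType.Exports.
Set Implicit Arguments.
Unset Strict Implicit.
Unset Printing Implicit Defensive.
Local Open Scope classical_set_scope.
Local Open Scope ring_scope.

(** Let E = F^2/2, let S = y^k d/dx^k - 2 G^k d/dy^k be the spray, and for a
constant vertical direction u let D = u^i d/dy^i, C = D^3 E (twice the Cartan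
torsion on u, u, u) and T = (d_i E) D^3 G^i (the y-component of the Berwald
curvature on u, u, u).  Commuting D with S gives S C = 3 (C with one slot moved
by N = dG/dy) - T, that is, T is minus the dynamical derivative of C.  Applying
D^2 to the definition of R^i_k and contracting with d_i E shows that
(d_i E) D^2 (R u)^i is minus the dynamical derivative of T; when
R^i_k = K(x) (F^2 delta^i_k - y^i y_k) the left-hand side is - K F^2 C.  The
assumed form of the Berwald curvature reads T = 3 mu(u) H(u) with
H = F^2 h(u, u), and H has zero dynamical derivative, so that constancy of mu
along geodesics makes the derivative of T vanish: then K F^2 C = 0, hence
C = 0, so g_ij does not depend on y.  Conversely C = 0 forces T = 0, hence
mu(u) = 0 whenever u is independent of y, and mu = 0 by linearity. *)

(** * Symmetry of second derivatives *)

Section Schwarz.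
Context {R : realType} {V : normedModType R}.
Implicit Types (f : V -> R) (U : set V).

(** The identities between derivatives are proved in an abstract commutative ring with derivations,
    which is later realised by the smooth functions on the slit bundle of a chart. Two data do not
    live in that ring. The curvature function [K] comes without regularity; it survives
    differentiation because only vertical derivatives of the curvature are taken and [K] is constant
    along fibres. The covector [mu] also comes without regularity, while its covariant derivative
    needs some; eliminating mu(w) between two values of the polarized formula for T exhibits each
    mu_i locally as a quotient of smooth functions. Flag curvature controls only g(R u, u), and only
    for u independent of y. Recovering R u requires the self-adjointness of R_y, which is derived
    from the spray identities, and a polarization that avoids the line of y; the latter is where a
    vector independent of y, hence 1 < n, enters. *)

Lemma dist_half (p q r e : R) :
  `|p - r| < e / 2 -> `|q - r| < e / 2 -> `|p - q| <= e.
Proof.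
move=> h1 h2; rewrite (_ : p - q = (p - r) - (q - r)); last by ring.
apply: le_trans (ler_normB _ _) _; rewrite [leRHS](splitr e); apply: lerD; exact: ltW.
Qed.

Lemma is_derive_line f (x w : V) (t : R) : derivable f (x + t *: w) w ->
  is_derive t 1 (fun r => f (x + r *: w)) ('D_w f (x + t *: w)).
Proof.
move=> df.
have E : (fun h : R => h^-1 *: (f (x + (h *: 1 + t) *: w) - f (x + t *: w))) =
         (fun h : R => h^-1 *: (f (h *: w + (x + t *: w)) - f (x + t *: w))).
  apply/funext => h; congr (_ *: (f _ - _)).
  by rewrite (_ : h *: 1 = h) ?scalerDl 1?addrCA//; exact: mulr1.
by split; [rewrite /derivable|rewrite /derive]; rewrite /= E.
Qed.

Lemma is_derive_translate f (x w c : V) : derivable f (x + c) w ->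
  is_derive x w (fun y => f (y + c)) ('D_w f (x + c)).
Proof.
move=> df.
have E : (fun h : R => h^-1 *: (f (h *: w + x + c) - f (x + c))) =
         (fun h : R => h^-1 *: (f (h *: w + (x + c)) - f (x + c))).
  by apply/funext => h; rewrite addrA.
by split; [rewrite /derivable|rewrite /derive]; rewrite /= E.
Qed.

Lemma MVT_line f (x w : V) (s : R) : 0 < s ->
  (forall t : R, 0 <= t <= s -> derivable f (x + t *: w) w) ->
  exists2 t, 0 < t < s & f (x + s *: w) - f x = s * 'D_w f (x + t *: w).
Proof.
move=> s0 df.
have dl (t : R) : 0 <= t <= s -> is_derive t 1 (fun r => f (x + r *: w)) ('D_w f (x + t *: w)).
  by move=> ts; apply: is_derive_line; exact: df.
have [| |t ts E] := @MVT R (fun r => f (x + r *: w)) (fun t => 'D_w f (x + t *: w)) 0 s s0.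
- by move=> t; rewrite in_itv/= => /andP[t0 ts]; apply: dl; rewrite !ltW.
- apply: derivable_within_continuous => t; rewrite in_itv/= => ts.
  exact: (@ex_derive _ _ _ _ _ _ _ (dl t ts)).
- exists t; first by move: ts; rewrite in_itv.
  by move: E; rewrite scale0r addr0 subr0 mulrC.
Qed.

(** The mean value theorem is applied to y -> f (y + s v) - f y in the direction [u], then to D_u f
    in the direction [v]. The left-hand side is symmetric in [u] and [v], which is what yields the
    exchange of derivatives. *)
Lemma second_difference U f (x u v : V) (s : R) : 0 < s ->
  (forall a b : R, 0 <= a <= s -> 0 <= b <= s -> U (x + a *: u + b *: v)) ->
  (forall y, U y -> derivable f y u) ->
  (forall y, U y -> derivable ('D_u f) y v) ->
  exists a b : R, [/\ 0 < a < s, 0 < b < s &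
    f (x + s *: u + s *: v) - f (x + s *: u) - (f (x + s *: v) - f x) =
      s * (s * 'D_v ('D_u f) (x + a *: u + b *: v))].
Proof.
move=> s0 Us du dv.
have s1 : 0 <= s <= s by rewrite (ltW s0) /=.
have s2 : (0 : R) <= 0 <= s by rewrite (ltW s0) andbT.
pose g y := f (y + s *: v) - f y.
have dg (a : R) : 0 <= a <= s ->
    is_derive (x + a *: u) u g ('D_u f (x + a *: u + s *: v) - 'D_u f (x + a *: u)).
  move=> as_.
  have h1 : is_derive (x + a *: u) u (fun y => f (y + s *: v)) ('D_u f (x + a *: u + s *: v)).
    by apply: is_derive_translate; apply: du; exact: Us.
  have h2 : is_derive (x + a *: u) u f ('D_u f (x + a *: u)).
    apply: derivableP; apply: du.
    by have := Us a 0 as_ s2; rewrite scale0r addr0.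
  exact: is_deriveB.
have [a as_ Ea] : exists2 a, 0 < a < s & g (x + s *: u) - g x = s * 'D_u g (x + a *: u).
  apply: (@MVT_line g x u s s0) => t ts; exact: (@ex_derive _ _ _ _ _ _ _ (dg t ts)).
have as' : 0 <= a <= s by case/andP: as_ => a0 sa; rewrite !ltW.
have [b bs Eb] : exists2 b, 0 < b < s &
    'D_u f (x + a *: u + s *: v) - 'D_u f (x + a *: u) =
    s * 'D_v ('D_u f) (x + a *: u + b *: v).
  apply: (@MVT_line ('D_u f) (x + a *: u) v s s0) => t ts; apply: dv; exact: Us.
exists a, b; split => //.
by rewrite -Eb -(@derive_val _ _ _ _ _ _ _ (dg a as')) -Ea.
Qed.

Lemma derive_swap U f (x u v : V) : open U -> U x ->
  (forall y, U y -> derivable f y u) -> (forall y, U y -> derivable f y v) ->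
  (forall y, U y -> derivable ('D_u f) y v) ->
  (forall y, U y -> derivable ('D_v f) y u) ->
  {for x, continuous ('D_v ('D_u f))} -> {for x, continuous ('D_u ('D_v f))} ->
  'D_v ('D_u f) x = 'D_u ('D_v f) x.
Proof.
move=> oU Ux du dv duv dvu cuv cvu.
apply/eqP; rewrite -subr_eq0 -normr_le0; apply/ler_addgt0Pr => e e0; rewrite add0r.
have e2 : 0 < e / 2 by rewrite divr_gt0.
have nbU : \forall y \near x, U y by apply: open_nbhs_nbhs; split.
have nb1 : \forall y \near x, `|'D_v ('D_u f) x - 'D_v ('D_u f) y| < e / 2.
  by move/cvgrPdist_lt: cuv => /(_ _ e2).
have nb2 : \forall y \near x, `|'D_u ('D_v f) x - 'D_u ('D_v f) y| < e / 2.
  by move/cvgrPdist_lt: cvu => /(_ _ e2).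
have : \forall y \near x, [/\ U y, `|'D_v ('D_u f) x - 'D_v ('D_u f) y| < e / 2 &
    `|'D_u ('D_v f) x - 'D_u ('D_v f) y| < e / 2].
  by apply: filterS3 nbU nb1 nb2 => y ? ? ?; split.
move=> /nbhs_ballP[d /= d0 dP].
(* The summand 1 keeps [k] positive when [u] and [v] vanish; with s = d / (2k) the parallelogram of
   sides s u and s v stays in the ball of radius [d]. *)
pose k := `|u| + `|v| + 1.
have k0 : 0 < k by rewrite ltr_wpDl// addr_ge0.
pose s := d / 2 / k.
have s0 : 0 < s by rewrite !divr_gt0.
have near_x (a b : R) : 0 <= a <= s -> 0 <= b <= s -> ball x d (x + a *: u + b *: v).
  move=> /andP[a0 as_] /andP[b0 bs]; rewrite -ball_normE /ball_/= -addrA opprD addNKr normrN.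
  apply: (le_lt_trans (ler_normD _ _)); rewrite !normrZ !ger0_norm//.
  apply: (@le_lt_trans _ _ (s * `|u| + s * `|v|)).
    by apply: lerD; apply: ler_wpM2r.
  apply: (@le_lt_trans _ _ (s * k)).
    by rewrite /k !mulrDr -addrA lerD2l lerDl mulr1 ltW.
  by rewrite /s mulfVK ?gt_eqF// ltr_pdivrMr// ltr_pMr// ltr1n.
have [a1 [b1 [a1s b1s E1]]] := second_difference s0
  (fun (a b : R) ha hb => let: And3 h _ _ := dP _ (near_x a b ha hb) in h) du duv.
have near_x' (a b : R) : 0 <= a <= s -> 0 <= b <= s -> ball x d (x + a *: v + b *: u).
  by move=> ha hb; rewrite addrAC; exact: near_x.
have [a2 [b2 [a2s b2s E2]]] := second_difference s0
  (fun (a b : R) ha hb => let: And3 h _ _ := dP _ (near_x' a b ha hb) in h) dv dvu.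
have cl (a : R) : 0 < a < s -> 0 <= a <= s by move=> /andP[? ?]; rewrite !ltW.
have [_ h1 _] := dP _ (near_x _ _ (cl _ a1s) (cl _ b1s)).
have [_ _ h2] := dP _ (near_x' _ _ (cl _ a2s) (cl _ b2s)).
have E : 'D_v ('D_u f) (x + a1 *: u + b1 *: v) = 'D_u ('D_v f) (x + a2 *: v + b2 *: u).
  have s00 : s != 0 by rewrite gt_eqF.
  apply: (mulfI s00); apply: (mulfI s00); apply: etrans (esym E1) (etrans _ E2).
  have -> : x + s *: u + s *: v = x + s *: v + s *: u by rewrite addrAC.
  have subrACA (p q r t : R) : p - q - (r - t) = p - r - (q - t) by ring.
  exact: subrACA.
rewrite E in h1; exact: (dist_half h1 h2).
Qed.

End Schwarz.

(** Formulas will agree with smooth functions on an open set only, so differentiability has to pass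
    through local equality. The differential of [f] gives a first-order expansion of [g], and
    uniqueness makes it the differential of [g]. *)
Lemma near_eq_differentiable (R : realType) (V W : normedModType R)
    (f g : V -> W) (x : V) :
  (\forall y \near x, f y = g y) -> differentiable f x -> differentiable g x.
Proof.
move=> fg df.
have E : g \o shift x = cst (g x) + 'd f x +o_ 0 id.
  apply/eqaddoP => e e0.
  have := diff_locally df => /eqaddoP/(_ _ e0).
  have : \forall h \near 0, f (h + x) = g (h + x).
    by move: fg; rewrite (near_shift 0 x); apply: filterS => h /=; rewrite subr0.
  apply: filterS2 => h fgh; rewrite /= -(nbhs_singleton fg) => ?.
  by move: (fgh); rewrite !fctE /= => <-.
apply/diff_locallyP; rewrite (diff_unique _ E); last exact: diff_continuous.
by split => //; exact: diff_continuous.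
Qed.

(** * Stability of C^k functions under ring operations and inversion *)

Section Smooth.
Context {R : realType} {V : normedModType R} (U : set V).
Hypothesis openU : open U.
Implicit Types f g : V -> R.

Fixpoint Ck k f : Prop :=
  (forall z, U z -> differentiable f z) /\
  (if k is k'.+1 then forall v, Ck k' ('D_v f) else True).

Lemma Ck_differentiable k f z : Ck k f -> U z -> differentiable f z.
Proof. by case: k => [|k] [h _]; exact: h. Qed.

Lemma CkS k f : Ck k.+1 f -> Ck k f.
Proof.
elim: k f => [|k IH] f [h1 h2]; split => // v; apply: IH.
exact: h2.
Qed.

Lemma smooth_onP f : smooth_on U f <-> forall k, Ck k f.
Proof.
split=> [sf k|cf s].
  elim: k f sf => [|k IH] f sf; split => //; try exact: (sf [::]).
  by move=> v; apply: IH => s; have := sf (rcons s v); rewrite /iter_derive foldr_rcons.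
elim/last_ind: s f cf => [|s v IH] f cf; first exact: (cf 0%N).1.
by rewrite /iter_derive foldr_rcons; apply: IH => k; exact: (cf k.+1).2.
Qed.

Lemma near_in z : U z -> \forall y \near z, U y.
Proof. by move=> Uz; apply: open_nbhs_nbhs; split. Qed.

Lemma near_eq_in f g z : U z -> (forall y, U y -> f y = g y) ->
  \forall y \near z, f y = g y.
Proof. by move=> Uz fg; move: (near_in Uz); apply: filterS. Qed.

Lemma derive_eq_in f g v : (forall y, U y -> f y = g y) ->
  forall z, U z -> 'D_v f z = 'D_v g z.
Proof. by move=> fg z Uz; apply: near_eq_derive; exact: near_eq_in. Qed.

Lemma Ck_eq k f g : (forall z, U z -> f z = g z) -> Ck k f -> Ck k g.
Proof.
elim: k f g => [|k IH] f g fg [df cf]; (split; first by move=> z Uz;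
  apply: (near_eq_differentiable (near_eq_in Uz fg)); exact: df) => //.
move=> v; apply: IH (cf v); exact: derive_eq_in.
Qed.

Lemma Ck_cst k (c : R) : Ck k (cst c).
Proof.
elim: k c => [|k IH] c; split => // v.
by apply: Ck_eq (IH 0) => z Uz; rewrite derive_cst.
Qed.

Lemma CkD k f g : Ck k f -> Ck k g -> Ck k (f + g).
Proof.
elim: k f g => [|k IH] f g cf cg; (split; first by move=> z Uz;
  apply: differentiableD; [exact: Ck_differentiable cf Uz|exact: Ck_differentiable cg Uz]) => //.
move=> v; apply: Ck_eq (IH _ _ (cf.2 v) (cg.2 v)) => z Uz.
by rewrite deriveD//; apply: diff_derivable; [exact: Ck_differentiable cf Uz|exact: Ck_differentiable cg Uz].
Qed.

Lemma CkM k f g : Ck k f -> Ck k g -> Ck k (f * g).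
Proof.
elim: k f g => [|k IH] f g cf cg; (split; first by move=> z Uz;
  apply: differentiableM; [exact: Ck_differentiable cf Uz|exact: Ck_differentiable cg Uz]) => //.
move=> v.
have h := CkD (IH _ _ (CkS cf) (cg.2 v)) (IH _ _ (CkS cg) (cf.2 v)).
apply: Ck_eq h => z Uz.
by rewrite deriveM//; apply: diff_derivable; [exact: Ck_differentiable cf Uz|exact: Ck_differentiable cg Uz].
Qed.

Lemma CkN k f : Ck k f -> Ck k (- f).
Proof.
move=> cf; apply: Ck_eq (CkM (Ck_cst k (-1)) cf) => z _.
by rewrite !fctE mulN1r.
Qed.

Lemma CkV k f : (forall z, U z -> f z != 0) -> Ck k f -> Ck k (fun z => (f z)^-1).
Proof.
move=> f0; elim: k => [|k IH] cf; (split; first by move=> z Uz;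
  apply: differentiableV; [exact: Ck_differentiable cf Uz|exact: f0]) => //.
(* The derivative of f^-1 is - f^-2 D_v f, and f^-1 is already of order k by induction. *)
move=> v; have cV := IH (CkS cf).
apply: Ck_eq (CkN (CkM (CkM cV cV) (cf.2 v))) => z Uz.
rewrite deriveV ?f0//; last by apply: diff_derivable; exact: Ck_differentiable cf Uz.
by rewrite !fctE -exprVn expr2 -mulNr.
Qed.

Lemma Ck_derive_swap f u v z : (forall k, Ck k f) -> U z ->
  'D_v ('D_u f) z = 'D_u ('D_v f) z.
Proof.
move=> cf Uz.
have d0 y w : U y -> derivable f y w.
  by move=> Uy; apply: diff_derivable; exact: Ck_differentiable (cf 0%N) Uy.
have d1 y w w' : U y -> derivable ('D_w f) y w'.
  move=> Uy; apply: diff_derivable.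
  by case: (cf 1%N) => _ /(_ w)[c _]; exact: c.
have d2 w w' : {for z, continuous ('D_w ('D_w' f))}.
  apply: differentiable_continuous.
  by case: (cf 2%N) => _ /(_ w')[_ /(_ w)[c _]]; exact: c.
by apply: (derive_swap openU Uz) => // y Uy; [exact: d0|exact: d0|exact: d1|exact: d1].
Qed.

End Smooth.

(** * The ring of smooth functions on an open set *)

Record opens (T : topologicalType) := Opens { opens_set :> T -> Prop; opensP : open opens_set }.

Section SmoothFun.
Context {R : realType} {V : normedModType R}.

(* Vanishing outside U makes Leibniz equality coincide with equality on U. *)
Record smooth_fun (U : opens V) := SmoothFun {
  sfun :> V -> R;
  sfunP : forall k, Ck U k sfun;
  sfun_out : forall z, ~ U z -> sfun z = 0
}.

Variable U : opens V.
Local Notation A := (smooth_fun U).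

HB.instance Definition _ := gen_eqMixin A.
HB.instance Definition _ := gen_choiceMixin A.

Lemma sfun_eq (f g : A) : (forall z, U z -> f z = g z) -> f = g.
Proof.
case: f g => [f fP f0] [g gP g0] /= fg.
have E : f = g.
  apply/funext => z; have [Uz|nUz] := pselect (U z); first exact: fg.
  by rewrite f0 ?g0.
by subst g; congr SmoothFun; exact: Prop_irrelevance.
Qed.

Definition restrict0 (f : V -> R) z := if `[< U z >] then f z else 0.

Lemma restrict0E f z : U z -> restrict0 f z = f z.
Proof. by move=> Uz; rewrite /restrict0 asboolT. Qed.

Fact restrict0P f : (forall k, Ck U k f) -> forall k, Ck U k (restrict0 f).
Proof. by move=> cf k; apply: Ck_eq (opensP U) _ _ _ _ (cf k) => z Uz; rewrite restrict0E. Qed.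

Fact restrict0_out f z : ~ U z -> restrict0 f z = 0.
Proof. by move=> nUz; rewrite /restrict0 asboolF. Qed.

Definition to_smooth f (cf : forall k, Ck U k f) : A :=
  SmoothFun (restrict0P cf) (@restrict0_out f).

Lemma to_smoothE f cf z : U z -> @to_smooth f cf z = f z.
Proof. exact: restrict0E. Qed.

Definition sadd (f g : A) : A :=
  to_smooth (fun k => CkD (opensP U) (sfunP f k) (sfunP g k)).
Definition smul (f g : A) : A :=
  to_smooth (fun k => CkM (opensP U) (sfunP f k) (sfunP g k)).
Definition sopp (f : A) : A := to_smooth (fun k => CkN (opensP U) (sfunP f k)).
Definition scst (c : R) : A := to_smooth (fun k => Ck_cst (opensP U) k c).

Lemma saddE f g z : U z -> sadd f g z = f z + g z.
Proof. exact: to_smoothE. Qed.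
Lemma smulE f g z : U z -> smul f g z = f z * g z.
Proof. exact: to_smoothE. Qed.
Lemma soppE f z : U z -> sopp f z = - f z.
Proof. exact: to_smoothE. Qed.
Lemma scstE c z : U z -> scst c z = c.
Proof. exact: to_smoothE. Qed.

Fact saddA : associative sadd.
Proof. by move=> f g h; apply: sfun_eq => z Uz; rewrite !saddE// addrA. Qed.
Fact saddC : commutative sadd.
Proof. by move=> f g; apply: sfun_eq => z Uz; rewrite !saddE// addrC. Qed.
Fact sadd0 : left_id (scst 0) sadd.
Proof. by move=> f; apply: sfun_eq => z Uz; rewrite !saddE// scstE// add0r. Qed.
Fact saddN : left_inverse (scst 0) sopp sadd.
Proof. by move=> f; apply: sfun_eq => z Uz; rewrite !saddE// scstE// soppE// addNr. Qed.

HB.instance Definition _ := GRing.isZmodule.Build A saddA saddC sadd0 saddN.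

Fact smulA : associative smul.
Proof. by move=> f g h; apply: sfun_eq => z Uz; rewrite !smulE// mulrA. Qed.
Fact smulC : commutative smul.
Proof. by move=> f g; apply: sfun_eq => z Uz; rewrite !smulE// mulrC. Qed.
Fact smul1 : left_id (scst 1) smul.
Proof. by move=> f; apply: sfun_eq => z Uz; rewrite !smulE// scstE// mul1r. Qed.
Fact smulDl : left_distributive smul +%R.
Proof. by move=> f g h; apply: sfun_eq => z Uz; rewrite !(smulE, saddE)// mulrDl. Qed.

HB.instance Definition _ :=
  GRing.Zmodule_isComPzRing.Build A smulA smulC smul1 smulDl.

Definition eval_at z (Uz : U z) (f : A) : R := f z.

Section Eval.
Variables (z : V) (Uz : U z).

Fact eval_at_is_additive : zmod_morphism (eval_at Uz).
Proof. by move=> f g; rewrite /eval_at [LHS]saddE// soppE. Qed.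
Fact eval_at_is_multiplicative : monoid_morphism (eval_at Uz).
Proof. by split=> [|f g]; [exact: scstE|exact: smulE]. Qed.

HB.instance Definition _ :=
  GRing.isZmodMorphism.Build A R (eval_at Uz) eval_at_is_additive.
HB.instance Definition _ :=
  GRing.isMonoidMorphism.Build A R (eval_at Uz) eval_at_is_multiplicative.

End Eval.

Lemma evalD (f g : A) z : U z -> (f + g) z = f z + g z.
Proof. exact: saddE. Qed.
Lemma evalM (f g : A) z : U z -> (f * g) z = f z * g z.
Proof. exact: smulE. Qed.
Lemma evalN (f : A) z : U z -> (- f) z = - f z.
Proof. exact: soppE. Qed.
Lemma evalB (f g : A) z : U z -> (f - g) z = f z - g z.
Proof. by move=> Uz; rewrite evalD// evalN. Qed.
Lemma eval0 z : (0 : A) z = 0.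
Proof. by have [?|?] := pselect (U z); [exact: scstE|exact: sfun_out]. Qed.
Lemma eval1 z : U z -> (1 : A) z = 1.
Proof. exact: scstE. Qed.
Lemma evalMn (f : A) m z : U z -> (f *+ m) z = f z *+ m.
Proof. by move=> Uz; rewrite -/(eval_at Uz (f *+ m)) rmorphMn. Qed.
Lemma eval_sum I (r : seq I) (P : pred I) (F : I -> A) z : U z ->
  (\sum_(i <- r | P i) F i) z = \sum_(i <- r | P i) F i z.
Proof. by move=> Uz; rewrite -/(eval_at Uz _) rmorph_sum. Qed.

Lemma scstD c d : scst (c + d) = scst c + scst d.
Proof. by apply: sfun_eq => z Uz; rewrite evalD// !scstE. Qed.
Lemma scst1 : scst 1 = 1. Proof. by []. Qed.

Lemma sfun_mulrn_inj m (f : A) : f *+ m.+1 = 0 -> f = 0.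
Proof.
move=> E; apply: sfun_eq => z Uz; rewrite eval0.
have := congr1 (fun h : A => h z) E; rewrite evalMn// eval0 => /eqP.
by rewrite mulrn_eq0 => /eqP.
Qed.

Fact der_subproof w (f : A) : {g : A | forall z, U z -> g z = 'D_w f z}.
Proof. by exists (to_smooth (fun k => (sfunP f k.+1).2 w)) => z; exact: to_smoothE. Qed.

(* Through an opaque proof: unification must not compare distinct derivatives
   by unfolding them. *)
Definition der w f : A := sval (der_subproof w f).

Lemma derE w f z : U z -> der w f z = 'D_w f z.
Proof. exact: svalP (der_subproof w f) z. Qed.

Lemma sfun_differentiable (f : A) z : U z -> differentiable f z.
Proof. exact: Ck_differentiable (sfunP f 0%N). Qed.

Lemma sfun_derivable (f : A) z w : U z -> derivable f z w.
Proof. by move=> Uz; apply: diff_derivable; exact: sfun_differentiable. Qed.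

Lemma derive_sfun (f : A) (g : V -> R) w z : (forall y, U y -> g y = f y) -> U z ->
  'D_w g z = der w f z.
Proof. by move=> gf Uz; rewrite derE//; exact: (derive_eq_in (opensP U)). Qed.

Lemma derD w (f g : A) : der w (f + g) = der w f + der w g.
Proof.
apply: sfun_eq => z Uz; rewrite evalD// !derE// -deriveD; [|exact: sfun_derivable..].
by apply: (derive_eq_in (opensP U)) => // y Uy; rewrite evalD.
Qed.

Lemma derM w (f g : A) : der w (f * g) = der w f * g + f * der w g.
Proof.
apply: sfun_eq => z Uz; rewrite evalD// !evalM// !derE//.
transitivity ('D_w ((f : V -> R) * (g : V -> R)) z).
  by apply: (derive_eq_in (opensP U)) => // y Uy; rewrite evalM.
by rewrite deriveM; [rewrite addrC mulrC|exact: sfun_derivable..].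
Qed.

Lemma der_scst w c : der w (scst c) = 0.
Proof.
apply: sfun_eq => z Uz; rewrite eval0 derE//.
rewrite (derive_eq_in (opensP U) (g := cst c))//; first exact: derive_cst.
by move=> y Uy; rewrite scstE.
Qed.

Lemma der_comm v w f : der v (der w f) = der w (der v f).
Proof.
apply: sfun_eq => z Uz.
have E u x : der u (der x f) z = 'D_u ('D_x f) z.
  apply: etrans (derE u (der x f) Uz) _; apply: (derive_eq_in (opensP U)) => // y Uy.
  exact: derE.
apply: etrans (E v w) (etrans _ (esym (E w v))).
exact: (Ck_derive_swap (opensP U) w v (sfunP f) Uz).
Qed.

Lemma der_linear a v w f : der (a *: v + w) f = scst a * der v f + der w f.
Proof.
apply: sfun_eq => z Uz; rewrite evalD// evalM// scstE// !derE//.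
have df := sfun_differentiable f Uz.
by rewrite !deriveE// linearP.
Qed.

Definition sinv (f : A) (f0 : forall z, U z -> f z != 0) : A :=
  to_smooth (fun k => CkV (opensP U) f0 (sfunP f k)).

Lemma sinvE f f0 z : U z -> @sinv f f0 z = (f z)^-1.
Proof. exact: to_smoothE. Qed.

End SmoothFun.
#[global] Arguments sfun : simpl never.

(** * Row vectors and polarization *)

Section RowVectors.
Context {R : realFieldType} {n : nat}.
Implicit Types y u v w : 'rV[R]_n.
Local Notation e i := (delta_mx 0 i : 'rV[R]_n).

Lemma free2P y u : y != 0 -> reflect (forall a, u <> a *: y) (free [:: y; u]).
Proof.
move=> y0; rewrite (@perm_free _ _ _ [:: u; y]) ?(perm_catC [:: y])//.
rewrite free_cons seq1_free y0 andbT span_seq1; apply: (iffP idP) => [uy a ua|uy].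
  by move/negP: uy; apply; apply/vlineP; exists a.
by apply/negP => /vlineP[a]; exact: uy.
Qed.

Lemma exists_free2 y : (1 < n)%N -> y != 0 -> exists w, free [:: y; w].
Proof.
move=> n1 y0; pose C := (<[y]>^C)%VS.
have C0 : C != 0%VS.
  have := dimv_compl <[y]>; rewrite dim_vline y0 dimvf /dim/= mul1n => dC.
  by rewrite -dimv_eq0 dC subn_eq0 -ltnNge.
exists (vpick C); apply/(free2P _ y0) => a E.
have : vpick C \in (<[y]> :&: C)%VS.
  by rewrite memv_cap memv_pick andbT E memvZ// memv_line.
by rewrite capv_compl memv0 vpick0 (negPf C0).
Qed.

Lemma free2_add y u w : free [:: y; w] -> ~~ free [:: y; u] -> free [:: y; u + w].
Proof.
move=> yw; have y0 : y != 0.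
  by apply/eqP => y0; move: yw; rewrite y0 free_cons mem0v.
apply: contraNT => yuw; apply/(free2P _ y0) => a uE; apply: (negP yuw).
apply/(free2P _ y0) => b; rewrite uE => /(canRL (addKr _)) wE.
by move/(free2P _ y0): yw => /(_ (b - a)); apply; rewrite wE scalerBl addrC.
Qed.

Lemma free2N y w : free [:: y; w] -> free [:: y; - w].
Proof.
move=> yw; have y0 : y != 0.
  by apply/eqP => y0; move: yw; rewrite y0 free_cons mem0v.
apply/(free2P _ y0) => a wE; move/(free2P _ y0): yw => /(_ (- a)); apply.
by rewrite scaleNr -wE opprK.
Qed.

(** A vector u dependent on [y] is the difference of u + w and w, both independent of [y]. *)
Lemma additive_free2_eq0 y (phi : 'rV[R]_n -> R) : (1 < n)%N -> y != 0 ->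
  (forall u v, phi (u + v) = phi u + phi v) ->
  (forall u, free [:: y; u] -> phi u = 0) -> forall u, phi u = 0.
Proof.
move=> n1 y0 phiD phi0 u; have [w yw] := exists_free2 n1 y0.
have [/phi0//|yu] := boolP (free [:: y; u]).
have := phi0 _ (free2_add yw yu); rewrite phiD (phi0 w yw) addr0; exact.
Qed.

(** If u is dependent on [y] and w is not, then u + w and u - w are both independent of [y]; since
    B(w, w) = 0, the two values of the quadratic form add up to 2 B(u, u). *)
Lemma quadratic_free2_eq0 y (B : 'rV[R]_n -> 'rV[R]_n -> R) : (1 < n)%N -> y != 0 ->
  (forall u v w, B (u + v) w = B u w + B v w) -> (forall u v, B u v = B v u) ->
  (forall u, free [:: y; u] -> B u u = 0) -> forall u v, B u v = 0.
Proof.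
move=> n1 y0 BD BC B0; have [w yw] := exists_free2 n1 y0.
have BD' a b d : B a (b + d) = B a b + B a d by rewrite BC BD !(BC a).
have diag u : B u u = 0.
  have [/B0//|yu] := boolP (free [:: y; u]).
  have BNr a : B a (- w) = - B a w.
    have B00 : B a 0 = 0 by apply: (addrI (B a 0)); rewrite -BD' !addr0.
    by apply/eqP; rewrite -addr_eq0 -BD' addNr B00.
  have BNl a : B (- w) a = - B w a by rewrite BC BNr BC.
  have := B0 _ (free2_add yw yu); have := B0 _ (free2_add (free2N yw) yu).
  rewrite !BD !BD' !BNl !BNr (B0 w yw); lra.
move=> u v; have := diag (u + v); rewrite BD !BD' !diag (BC v u); lra.
Qed.

Lemma trilinear_ext (T1 T2 : 'rV[R]_n -> 'rV[R]_n -> 'rV[R]_n -> R) :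
  (forall u v w, T1 u v w = \sum_i u 0 i * T1 (e i) v w) ->
  (forall u v w, T2 u v w = \sum_i u 0 i * T2 (e i) v w) ->
  (forall u v w, T1 u v w = T1 v u w) -> (forall u v w, T1 u v w = T1 u w v) ->
  (forall u v w, T2 u v w = T2 v u w) -> (forall u v w, T2 u v w = T2 u w v) ->
  (forall i j k, T1 (e i) (e j) (e k) = T2 (e i) (e j) (e k)) ->
  forall u v w, T1 u v w = T2 u v w.
Proof.
move=> L1 L2 A1 B1 A2 B2 T12.
have H1 u j k : T1 u (e j) (e k) = T2 u (e j) (e k).
  by rewrite L1 L2; apply: eq_bigr => i _; rewrite T12.
have H2 u v k : T1 u v (e k) = T2 u v (e k).
  by rewrite A1 A2 L1 L2; apply: eq_bigr => i _; rewrite A1 A2 H1.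
move=> u v w; rewrite B1 B2 A1 A2 L1 L2; apply: eq_bigr => i _.
by rewrite A1 A2 B1 B2 H2.
Qed.

End RowVectors.

Lemma cubic_polarization (V W : zmodType) (C : V -> V -> V -> W) :
  (forall m (f : W), f *+ m.+1 = 0 -> f = 0) ->
  (forall u v w x, C (u + v) w x = C u w x + C v w x) ->
  (forall u v w, C u v w = C v u w) -> (forall u v w, C u v w = C u w v) ->
  (forall u, C u u u = 0) -> forall u v w, C u v w = 0.
Proof.
move=> tf D1 C12 C23 C0.
have D2 u v w x : C w (u + v) x = C w u x + C w v x by rewrite C12 D1 !(C12 w).
have D3 u v w x : C w x (u + v) = C w x u + C w x v by rewrite C23 D2 !(C23 w x).
have N2 u v w : C u (- v) w = - C u v w.
  have C00 : C u 0 w = 0 by apply: (addrI (C u 0 w)); rewrite -D2 !addr0.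
  by apply/eqP; rewrite -addr_eq0 -D2 addNr C00.
have N3 u v w : C u v (- w) = - C u v w by rewrite C23 N2 C23.
have add3 a b : C a a b *+ 3 + C a b b *+ 3 = 0.
  have := C0 (a + b); rewrite !D1 !D2 !D3 !C0 add0r addr0.
  rewrite (C23 a b a) (C12 b a a) (C23 a b a) (C12 b a b) (C23 b b a) (C12 b a b).
  move=> E; rewrite -mulrnDl !mulrS mulr0n addr0 -[RHS]E.
  by rewrite [C a a b + C a b b + C a b b]addrC addrACA.
have abb a b : C a b b = 0.
  (* Adding [add3] at b and at -b leaves 6 C(a, b, b); the argument 5 of [tf] encodes the factor
     6. *)
  apply: (tf 5%N); have := add3 a (- b); rewrite N3 N3 N2 opprK => E.
  have : (C a a b *+ 3 + C a b b *+ 3) + ((- C a a b) *+ 3 + C a b b *+ 3) = 0.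
    by rewrite add3 E addr0.
  by rewrite addrACA mulNrn subrr add0r -mulrnDr.
move=> u v w; have := abb u (v + w); rewrite D2 !D3 !abb add0r addr0 (C23 u w v).
by rewrite -mulr2n => /tf.
Qed.

(** * Spray calculus over a commutative ring *)

Record is_derivation (A : pzRingType) (d : A -> A) : Prop := IsDerivation {
  derivationD : forall f g, d (f + g) = d f + d g;
  derivationM : forall f g, d (f * g) = d f * g + f * d g
}.

Section Derivation.
Context {A : pzRingType} {d : A -> A}.
Hypothesis dd : is_derivation d.

Lemma derivation0 : d 0 = 0.
Proof. by apply: (addrI (d 0)); rewrite -(derivationD dd) !addr0. Qed.

Lemma derivationN f : d (- f) = - d f.
Proof. by apply/eqP; rewrite -addr_eq0 -(derivationD dd) addNr derivation0. Qed.

Lemma derivation_mulrn f m : d (f *+ m) = d f *+ m.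
Proof. by elim: m => [|m IH]; rewrite ?derivation0// !mulrS (derivationD dd) IH. Qed.

Lemma derivation_sum I (r : seq I) (P : pred I) (F : I -> A) :
  d (\sum_(i <- r | P i) F i) = \sum_(i <- r | P i) d (F i).
Proof. exact: (big_morph d (derivationD dd) derivation0). Qed.

Definition derivationE := (derivationD dd, derivationN, derivation_mulrn, derivationM dd).

End Derivation.

(* Functions of the coordinates (x, y): vder u and hder u are the derivatives in
   the constant direction u on the y's and on the x's, and cst_coord u i is the
   constant function u^i. *)
Record fiber_calculus (A : comPzRingType) (n : nat) (T : Type) := FiberCalculus {
  vder : T -> A -> A;
  hder : T -> A -> A;
  ed : 'I_n -> T;
  cst_coord : T -> 'I_n -> A;
  yv : 'I_n -> A;
  D_derivation : forall u, is_derivation (vder u);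
  X_derivation : forall u, is_derivation (hder u);
  D_comm : forall u v f, vder u (vder v f) = vder v (vder u f);
  X_comm : forall u v f, hder u (hder v f) = hder v (hder u f);
  DX_comm : forall u v f, vder u (hder v f) = hder v (vder u f);
  D_expand : forall u f, vder u f = \sum_i cst_coord u i * vder (ed i) f;
  X_expand : forall u f, hder u f = \sum_i cst_coord u i * hder (ed i) f;
  D_cst_coord : forall u v i, vder u (cst_coord v i) = 0;
  X_cst_coord : forall u v i, hder u (cst_coord v i) = 0;
  D_yv : forall u i, vder u (yv i) = cst_coord u i;
  X_yv : forall u i, hder u (yv i) = 0;
  half : forall f : A, f *+ 2 = 0 -> f = 0
}.

Section SprayCalculus.
Context {A : comPzRingType} {n : nat} {T : Type} (c : fiber_calculus A n T).
Implicit Types (u v w : T) (f g : A) (W Z : 'I_n -> A).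
Local Notation D := (vder c).
Local Notation X := (hder c).
Local Notation e := (ed c).
Local Notation y := (yv c).
Local Notation DD := (D_derivation c).
Local Notation XX := (X_derivation c).

(* [vert W] is W^i d/dy^i, [horiz] is y^k d/dx^k and [spray_der] is the spray
   y^k d/dx^k - 2 G^k d/dy^k.  They are locked so that the Leibniz rules do not
   see through them. *)
Fact spray_key : unit. Proof. by []. Qed.
Definition vert W := locked_with spray_key (fun f => \sum_i W i * D (e i) f).

Lemma vertE W f : vert W f = \sum_i W i * D (e i) f.
Proof. by rewrite /vert unlock. Qed.

Lemma vert_derivation W : is_derivation (vert W).
Proof.
split=> f g; rewrite !vertE.
  by rewrite -big_split; apply: eq_bigr => i _; rewrite derivationE ?mulrDr//; exact: DD.
rewrite mulr_suml mulr_sumr -big_split; apply: eq_bigr => i _ /=.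
by rewrite (derivationM (DD _)); ring.
Qed.

Lemma D_vert u W f : D u (vert W f) = vert (D u \o W) f + vert W (D u f).
Proof.
rewrite !vertE (derivation_sum (DD u)) -big_split; apply: eq_bigr => i _ /=.
by rewrite (derivationM (DD u)) (D_comm c u).
Qed.

Lemma X_vert u W f : X u (vert W f) = vert (X u \o W) f + vert W (X u f).
Proof.
rewrite !vertE (derivation_sum (XX u)) -big_split; apply: eq_bigr => i _ /=.
by rewrite (derivationM (XX u)) -(DX_comm c).
Qed.

Variable G : 'I_n -> A.

Definition horiz := locked_with spray_key (fun f => \sum_k y k * X (e k) f).
Definition spray_der := locked_with spray_key (fun f => horiz f - vert G f *+ 2).

Lemma horizE f : horiz f = \sum_k y k * X (e k) f.
Proof. by rewrite /horiz unlock. Qed.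
Local Notation S := spray_der.

Lemma SE f : S f = horiz f - vert G f *+ 2.
Proof. by rewrite /spray_der unlock. Qed.

Lemma horiz_derivation : is_derivation horiz.
Proof.
split=> f g; rewrite !horizE.
  by rewrite -big_split; apply: eq_bigr => i _; rewrite (derivationD (XX _)) mulrDr.
rewrite mulr_suml mulr_sumr -big_split; apply: eq_bigr => i _ /=.
by rewrite (derivationM (XX _)); ring.
Qed.

Lemma S_derivation : is_derivation S.
Proof.
split=> f g; rewrite !SE; first by
  rewrite (derivationD horiz_derivation) (derivationD (vert_derivation G)); ring.
by rewrite (derivationM horiz_derivation) (derivationM (vert_derivation G)); ring.
Qed.
Local Notation SD := S_derivation.

Lemma D_horiz u f : D u (horiz f) = horiz (D u f) + X u f.
Proof.
rewrite !horizE (derivation_sum (DD u)) [X u f]X_expand -big_split; apply: eq_bigr => i _ /=.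
by rewrite (derivationM (DD u)) D_yv DX_comm addrC.
Qed.

Lemma X_horiz u f : X u (horiz f) = horiz (X u f).
Proof.
rewrite !horizE (derivation_sum (XX u)); apply: eq_bigr => i _ /=.
by rewrite (derivationM (XX u)) X_yv mul0r add0r X_comm.
Qed.

Lemma D_S u f : D u (S f) = S (D u f) + X u f - vert (D u \o G) f *+ 2.
Proof.
rewrite !SE (derivationD (DD u)) (derivationN (DD u)) (derivation_mulrn (DD u)).
by rewrite D_horiz D_vert; ring.
Qed.

Lemma S_X u f : S (X u f) = X u (S f) + vert (X u \o G) f *+ 2.
Proof.
rewrite !SE (derivationD (XX u)) (derivationN (XX u)) (derivation_mulrn (XX u)).
by rewrite X_horiz X_vert; ring.
Qed.

Lemma S_vert W f : S (vert W f) = vert (S \o W) f + \sum_i W i * S (D (e i) f).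
Proof.
rewrite !vertE (derivation_sum SD) -big_split; apply: eq_bigr => i _ /=.
by rewrite (derivationM SD).
Qed.

Lemma S_cst_coord u i : S (cst_coord c u i) = 0.
Proof.
rewrite !SE !horizE !vertE big1 => [|j _]; last by rewrite X_cst_coord mulr0.
by rewrite big1 ?mul0rn ?subr0// => j _; rewrite D_cst_coord mulr0.
Qed.

Lemma horiz_yv i : horiz (y i) = 0.
Proof. by rewrite !horizE big1// => k _; rewrite X_yv mulr0. Qed.

(* The component i of R_y(u). *)
Definition riem u i := X u (G i) *+ 2 - S (D u (G i)) - vert (D u \o G) (G i).

Lemma DD_riem u i : D u (D u (riem u i)) =
  - S (D u (D u (D u (G i)))) + vert (D u \o G) (D u (D u (G i))) *+ 3
  - vert (D u \o (D u \o (D u \o G))) (G i).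
Proof.
rewrite /riem !(derivationD (DD u), derivationN (DD u), derivation_mulrn (DD u)).
rewrite !(D_S, D_vert, derivationD (DD u), derivationN (DD u), derivation_mulrn (DD u)).
rewrite !(DX_comm c); ring.
Qed.

(** * Identities for the energy along its geodesic spray *)

Section Energy.
Variable E : A.
Hypothesis euler : \sum_i y i * D (e i) E = E *+ 2.
Hypothesis geodesic : forall l,
  vert G (D (e l) E) *+ 2 = horiz (D (e l) E) - X (e l) E.

(** The Euler-Lagrange equation of [E], of which [geodesic] is the coordinate form. *)
Lemma S_DE u : S (D u E) = X u E.
Proof.
rewrite [D u E]D_expand [X u E]X_expand (derivation_sum SD); apply: eq_bigr => i _.
by rewrite (derivationM SD) S_cst_coord mul0r add0r SE geodesic; ring.
Qed.

Lemma euler_D u : \sum_i y i * D (e i) (D u E) = D u E.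
Proof.
have := congr1 (D u) euler.
rewrite (derivation_sum (DD u)) (derivation_mulrn (DD u)).
under eq_bigr => i _ do rewrite (derivationM (DD u)) D_yv (D_comm c u).
by rewrite big_split /= -D_expand mulr2n => /addrI.
Qed.

(** Conservation of energy: [geodesic] is contracted with y^l, and Euler's relation is used for [E]
    and for its vertical derivatives. *)
Lemma S_E : S E = 0.
Proof.
have E1 : vert G E = \sum_l y l * vert G (D (e l) E).
  rewrite !vertE; under eq_bigr => i _ do rewrite -euler_D mulr_sumr.
  rewrite exchange_big; apply: eq_bigr => l _; rewrite vertE mulr_sumr.
  by apply: eq_bigr => i _; rewrite (D_comm c (e l)); ring.
have E2 : \sum_l y l * horiz (D (e l) E) = horiz E *+ 2.
  rewrite -(derivation_mulrn horiz_derivation) -euler (derivation_sum horiz_derivation).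
  apply: eq_bigr => l _; rewrite (derivationM horiz_derivation).
  by rewrite horiz_yv mul0r add0r.
rewrite SE E1 -sumrMnl; under eq_bigr => l _ do rewrite -mulrnAr geodesic mulrBr.
by rewrite sumrB E2 -horizE; ring.
Qed.

(** A vertical derivative of S E = 0 gives twice this identity. It says that [E] is constant in the
    horizontal directions of the Berwald connection, and it trades x-derivatives of [E] for vertical
    ones. *)
Lemma X_E u : X u E = vert (D u \o G) E.
Proof.
apply/eqP; rewrite -subr_eq0; apply/eqP/(half c).
have := D_S u E; rewrite S_E (derivation0 (DD u)) S_DE => ->; ring.
Qed.

Lemma X_DE u v : X u (D v E) = vert (D v \o (D u \o G)) E + vert (D u \o G) (D v E).
Proof. by rewrite -DX_comm X_E D_vert. Qed.

Lemma vert_DDC u v f : vert (D v \o (D u \o G)) f = vert (D u \o (D v \o G)) f.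
Proof. by rewrite !vertE; apply: eq_bigr => i _ /=; rewrite D_comm. Qed.

(** The right-hand side moves each slot of g(u, v) by N, so this is the vanishing of the dynamical
    derivative of g. *)
Lemma S_DDE u v : S (D v (D u E)) = vert (D u \o G) (D v E) + vert (D v \o G) (D u E).
Proof.
have := congr1 (D v) (S_DE u); rewrite D_S DX_comm !X_DE (vert_DDC u v) => E1.
have -> : S (D v (D u E)) = (S (D v (D u E)) +
    (vert (D u \o (D v \o G)) E + vert (D v \o G) (D u E)) -
    vert (D v \o G) (D u E) *+ 2) - vert (D u \o (D v \o G)) E + vert (D v \o G) (D u E).
  by ring.
by rewrite E1; ring.
Qed.

Definition landsberg u := vert (D u \o (D u \o (D u \o G))) E.

Lemma S_DDDE u : S (D u (D u (D u E))) =
  vert (D u \o G) (D u (D u E)) *+ 3 - landsberg u.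
Proof.
have := congr1 (D u) (S_DDE u u).
rewrite D_S (derivationD (DD u)) !D_vert.
have -> : X u (D u (D u E)) = landsberg u + vert (D u \o (D u \o G)) (D u E) *+ 2 +
    vert (D u \o G) (D u (D u E)).
  rewrite -DX_comm X_DE (derivationD (DD u)) !D_vert /landsberg; ring.
set a := S _; set b := landsberg u; set p := vert _ (D u E); set q := vert _ _ => E1.
have -> : a = (a + (b + p *+ 2 + q) - q *+ 2) - b - p *+ 2 + q by ring.
by rewrite E1; ring.
Qed.

(** In S T the factor d_i E is differentiated into X_i E, that is (d_i G^j) d_j E by [X_E], which
    matches the last term of [DD_riem]. The sum with coefficient 3 moves one slot of T by N, so the
    right-hand side is minus the dynamical derivative of T. *)
Lemma riem_landsberg u :
  \sum_i D (e i) E * D u (D u (riem u i)) =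
  - S (landsberg u) + (\sum_i D (e i) E * vert (D u \o G) (D u (D u (G i)))) *+ 3.
Proof.
rewrite /landsberg S_vert.
have -> : \sum_i (D u \o (D u \o (D u \o G))) i * S (D (e i) E) =
    \sum_i D (e i) E * vert (D u \o (D u \o (D u \o G))) (G i).
  under eq_bigr => i _ do rewrite S_DE X_E vertE mulr_sumr.
  rewrite exchange_big; apply: eq_bigr => i _; rewrite !vertE mulr_sumr.
  by apply: eq_bigr => j _ /=; ring.
under eq_bigr => i _ do rewrite DD_riem.
rewrite -sumrMnl !vertE opprD -!sumrN -!big_split.
by apply: eq_bigr => i _ /=; ring.
Qed.

(** This is F^2 h(u, v) for the angular metric h: the factor F^2 = 2E clears the denominator, and on
    the diagonal it is the denominator of the flag curvature. *)
Definition angular u v := E *+ 2 * D u (D v E) - D u E * D v E.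

Lemma angularC u v : angular u v = angular v u.
Proof. by rewrite /angular (D_comm c u); ring. Qed.

Lemma vert_angular W u :
  \sum_i W i * angular (e i) u = E *+ 2 * vert W (D u E) - vert W E * D u E.
Proof.
rewrite !vertE mulr_sumr mulr_suml -sumrB; apply: eq_bigr => i _.
by rewrite /angular; ring.
Qed.

Lemma S_angular u : S (angular u u) = (\sum_i D u (G i) * angular (e i) u) *+ 2.
Proof.
rewrite [X in X *+ 2](vert_angular (D u \o G)) /angular.
rewrite (derivationD SD) (derivationN SD) !(derivationM SD) (derivation_mulrn SD).
by rewrite S_DDE S_DE S_E X_E; ring.
Qed.

Definition landsberg_form u v w := vert (D u \o (D v \o (D w \o G))) E.

Lemma landsberg_formC u v w : landsberg_form u v w = landsberg_form v u w.
Proof. by rewrite /landsberg_form !vertE; apply: eq_bigr => i _ /=; rewrite (D_comm c u). Qed.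

Lemma landsberg_formA u v w : landsberg_form u v w = landsberg_form u w v.
Proof. by rewrite /landsberg_form !vertE; apply: eq_bigr => i _ /=; rewrite (D_comm c v). Qed.

Lemma landsberg_form_expand u v w :
  landsberg_form u v w = \sum_i cst_coord c u i * landsberg_form (e i) v w.
Proof.
rewrite /landsberg_form vertE; under [RHS]eq_bigr => i _ do rewrite vertE mulr_sumr.
rewrite exchange_big; apply: eq_bigr => j _; rewrite [(_ \o _) j](D_expand c u) mulr_suml.
by apply: eq_bigr => i _ /=; ring.
Qed.

Lemma vert_landsberg u :
  \sum_i D (e i) E * vert (D u \o G) (D u (D u (G i))) =
  \sum_r D u (G r) * landsberg_form (e r) u u.
Proof.
under eq_bigr => i _ do rewrite vertE mulr_sumr.
rewrite exchange_big; apply: eq_bigr => r _; rewrite /landsberg_form vertE mulr_sumr.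
by apply: eq_bigr => i _ /=; ring.
Qed.

Definition riem_form u v := \sum_i riem u i * D (e i) (D v E).

(** Self-adjointness of R_y for g_y. The formula for [riem] is not visibly symmetric; moving [S] out
    of the contraction with g leads to [riem_formE], where symmetry follows from commuting
    derivatives. *)
Lemma riem_form_sym u v : riem_form u v = riem_form v u.
Proof.
suff riem_formE a b : riem_form a b =
    S (vert (D a \o (D b \o G)) E) - X a (X b E) +
    \sum_i \sum_j D a (G i) * D b (G j) * D (e i) (D (e j) E).
  rewrite !riem_formE vert_DDC X_comm; congr (_ + _).
  rewrite exchange_big; apply: eq_bigr => i _; apply: eq_bigr => j _.
  by rewrite (D_comm c (e i)); ring.
have E1 : vert (X a \o G) (D b E) *+ 2 = S (X a (D b E)) - X a (X b E).
  by rewrite S_X S_DE; ring.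
have E2 : vert (S \o (D a \o G)) (D b E) + \sum_i (D a \o G) i * S (D (e i) (D b E)) =
    S (vert (D a \o G) (D b E)) by rewrite S_vert.
have E3 : \sum_i D a (G i) * S (D (e i) (D b E)) =
    \sum_i vert (D a \o G) (G i) * D (e i) (D b E) +
    \sum_i \sum_j D a (G i) * D b (G j) * D (e i) (D (e j) E).
  under eq_bigr => i _ do rewrite S_DDE mulrDr.
  rewrite big_split addrC /=; congr (_ + _).
    apply: eq_bigr => i _; rewrite !vertE mulr_sumr; apply: eq_bigr => j _ /=.
    by rewrite (D_comm c (e i)); ring.
  under eq_bigr => i _ do rewrite vertE mulr_sumr.
  under [RHS]eq_bigr => i _ do rewrite vertE mulr_suml.
  by rewrite exchange_big; apply: eq_bigr => i _; apply: eq_bigr => j _ /=; ring.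
have -> : riem_form a b = vert (X a \o G) (D b E) *+ 2 -
    vert (S \o (D a \o G)) (D b E) - \sum_i vert (D a \o G) (G i) * D (e i) (D b E).
  rewrite /riem_form /riem !vertE -sumrMnl -!sumrB; apply: eq_bigr => i _ /=; ring.
have -> : vert (S \o (D a \o G)) (D b E) =
    S (vert (D a \o G) (D b E)) - \sum_i D a (G i) * S (D (e i) (D b E)).
  by rewrite -E2; ring.
rewrite E1 E3 X_DE (derivationD SD) (vert_DDC a b); ring.
Qed.

Lemma vert_y_D u f : vert y (D u f) = D u (vert y f) - D u f.
Proof.
rewrite D_vert [X in _ = X + _ - _]vertE [X in _ = _ - X]D_expand.
by under eq_bigr => i _ do rewrite /= D_yv; rewrite addrC addKr.
Qed.

Lemma vert_y_horiz f : vert y (horiz f) = horiz f + horiz (vert y f).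
Proof.
rewrite !vertE [X in _ = _ + X](derivation_sum horiz_derivation) [X in _ = X + _]horizE.
rewrite -big_split; apply: eq_bigr => i _ /=.
by rewrite D_horiz (derivationM horiz_derivation) horiz_yv; ring.
Qed.

Lemma vert_y_X u f : vert y (X u f) = X u (vert y f).
Proof.
rewrite X_vert !vertE [X in _ = X + _]big1 ?add0r => [|i _]; last by rewrite /= X_yv mul0r.
by apply: eq_bigr => i _; rewrite DX_comm.
Qed.

(** Euler's relation for [G] in degree 2, with the index lowered because no inverse of g is
    available here. It results from applying y^i d_i to [geodesic], whose right-hand side has degree
    2 while g has degree 0. *)
Lemma vert_y_G l : vert (vert y \o G) (D (e l) E) = vert G (D (e l) E) *+ 2.
Proof.
have yE : vert y E = E *+ 2 by rewrite vertE.
have yDE u : vert y (D u E) = D u E by rewrite vertE euler_D.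
apply/eqP; rewrite -subr_eq0; apply/eqP/(half c).
have := congr1 (vert y) (geodesic l).
rewrite (derivation_mulrn (vert_derivation y)) (derivationD (vert_derivation y)).
rewrite (derivationN (vert_derivation y)) vert_y_horiz vert_y_X yE yDE.
rewrite (derivation_mulrn (X_derivation c _)) [X in vert y X]vertE.
rewrite (derivation_sum (vert_derivation y)).
under eq_bigr => i _ do rewrite (derivationM (vert_derivation y)) vert_y_D yDE subrr mulr0 addr0.
rewrite -[\sum_i _]/(\sum_i (vert y \o G) i * _) -vertE => E1.
by rewrite mulrnBl E1 geodesic; ring.
Qed.

End Energy.

(** For f = E the argument is R_y(u)^i divided by K in the isotropic case. The terms in u^i cancel
    because u^i is also the derivative of y^i. *)
Lemma DD_isotropic u i f : D u (D u (f *+ 2 * cst_coord c u i - y i * D u f)) =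
  - (y i * D u (D u (D u f))).
Proof.
have H a b : D u (a *+ 2 * cst_coord c u i - b) = D u a *+ 2 * cst_coord c u i - D u b.
  rewrite (derivationD (DD u)) (derivationN (DD u)) (derivationM (DD u)) D_cst_coord.
  by rewrite (derivation_mulrn (DD u)); ring.
have H2 a b : D u (cst_coord c u i * a + b) = cst_coord c u i * D u a + D u b.
  by rewrite (derivationD (DD u)) (derivationM (DD u)) D_cst_coord mul0r add0r.
rewrite H (derivationM (DD u)) D_yv H H2 (derivationM (DD u)) D_yv; ring.
Qed.

Lemma riem_expand u i : riem u i = \sum_k cst_coord c u k * riem (e k) i.
Proof.
have SDG : S (D u (G i)) = \sum_k cst_coord c u k * S (D (e k) (G i)).
  rewrite D_expand (derivation_sum SD); apply: eq_bigr => k _.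
  by rewrite (derivationM SD) S_cst_coord mul0r add0r.
have vDG : vert (D u \o G) (G i) = \sum_k cst_coord c u k * vert (D (e k) \o G) (G i).
  under [RHS]eq_bigr => k _ do rewrite vertE mulr_sumr.
  rewrite exchange_big vertE; apply: eq_bigr => j _ /=.
  by rewrite D_expand mulr_suml; apply: eq_bigr => k _; ring.
rewrite /riem SDG vDG X_expand -sumrMnl -!sumrB.
by apply: eq_bigr => k _; ring.
Qed.
End SprayCalculus.

(** * Coordinates on the tangent space *)

Section Coordinates.
Context {R : realType} {n : nat}.
Local Notation V := ('rV[R]_n * 'rV[R]_n)%type.
Local Notation e i := (delta_mx 0 i : 'rV[R]_n).

Lemma yc_is_derive i (z v : V) : is_derive z v (yc i) (v.2 0 i).
Proof.
have E : \forall h \near (0 : R)^', (h^-1 *: (yc i (h *: v + z) - yc i z)) = v.2 0 i.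
  near=> h; have h0 : h != 0 by near: h; exact: nbhs_dnbhs_neq.
  by rewrite /yc/= !mxE addrK /GRing.scale/= mulKf.
have C : h^-1 *: (yc i (h *: v + z) - yc i z) @[h --> (0 : R)^'] --> v.2 0 i.
  apply: (@cvg_trans _ ((fun=> v.2 0 i) @ (0 : R)^')); last exact: cvg_cst.
  by apply: near_eq_cvg; apply: filterS E => h /= ->.
by split; [apply/cvg_ex; exists (v.2 0 i)|exact: cvg_lim C].
Unshelve. all: by end_near. Qed.

Lemma yc_differentiable i (z : V) : differentiable (yc i) z.
Proof.
apply: (@differentiable_comp _ _ _ _ snd (fun M : 'rV[R]_n => M 0 i)).
  by apply: linear_differentiable => x; exact: cvg_snd.
exact: differentiable_coord.
Qed.

Lemma vec_expand (u : 'rV[R]_n) : u = \sum_i u 0 i *: e i.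
Proof. exact: row_sum_delta. Qed.

Lemma horizontal_expand (u : 'rV[R]_n) : (u, 0) = \sum_i u 0 i *: (e i, 0) :> V.
Proof.
rewrite [in LHS](vec_expand u).
apply: (big_ind2 (fun (a : 'rV[R]_n) (w : V) => (a, 0) = w)) => [//|a v b w <- <-|i _].
  by congr (_, _); rewrite addr0.
by congr (_, _); rewrite scaler0.
Qed.

Lemma vertical_expand (u : 'rV[R]_n) : (0, u) = \sum_i u 0 i *: (0, e i) :> V.
Proof.
rewrite [in LHS](vec_expand u).
apply: (big_ind2 (fun (a : 'rV[R]_n) (w : V) => (0, a) = w)) => [//|a v b w <- <-|i _].
  by congr (_, _); rewrite addr0.
by congr (_, _); rewrite scaler0.
Qed.

Lemma derive_pair (f : V -> R) z (a b : 'rV[R]_n) : differentiable f z ->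
  'D_(a, b) f z = \sum_i a 0 i * dx i f z + \sum_i b 0 i * dy i f z.
Proof.
move=> df; have -> : (a, b) = (a, 0) + (0, b) :> V by congr (_, _); rewrite ?addr0 ?add0r.
rewrite deriveE// linearD/= horizontal_expand vertical_expand !linear_sum.
by congr (_ + _); apply: eq_bigr => i _; rewrite linearZ/= /dx /dy deriveE.
Qed.

Variable U : opens V.
Local Notation A := (smooth_fun U).

Lemma yc_Ck i k : Ck U k (yc i).
Proof.
case: k => [|k]; (split; first by move=> z _; exact: yc_differentiable) => // v.
apply: Ck_eq (opensP U) _ _ _ _ (Ck_cst (opensP U) k (v.2 0 i)) => z _.
by rewrite (@derive_val _ _ _ _ _ _ _ (yc_is_derive i z v)).
Qed.

Definition ysm i : A := to_smooth (yc_Ck i).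

Lemma ysmE i z : U z -> ysm i z = z.2 0 i.
Proof. exact: to_smoothE. Qed.

Lemma der_ysm i w : der w (ysm i) = scst U (w.2 0 i).
Proof.
apply: sfun_eq => z Uz; rewrite scstE//.
rewrite -(@derive_val _ _ _ _ _ _ _ (yc_is_derive i z w)).
by apply/esym/derive_sfun => // y Uy; rewrite ysmE.
Qed.

Lemma der_dir0 (f : A) : der 0 f = 0.
Proof. by apply: sfun_eq => z Uz; rewrite derE// eval0 derive0. Qed.

Lemma der_dir_sum (a : 'I_n -> R) (v : 'I_n -> V) (f : A) :
  der (\sum_i a i *: v i) f = \sum_i scst U (a i) * der (v i) f.
Proof.
apply: (big_ind2 (fun w g => der w f = g)) => [|w1 g1 w2 g2 <- <-|i _].
- exact: der_dir0.
- by rewrite -[w1]scale1r der_linear scst1 mul1r scale1r.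
- by rewrite -[_ *: _]addr0 der_linear der_dir0 addr0.
Qed.

Lemma der_is_derivation w : is_derivation (@der R V U w).
Proof. by split=> f g; [exact: derD|exact: derM]. Qed.

Fact D_expand_subproof u (f : A) :
  der (0, u) f = \sum_i scst U (u 0 i) * der (0, e i) f.
Proof. by rewrite vertical_expand der_dir_sum. Qed.

Fact X_expand_subproof u (f : A) :
  der (u, 0) f = \sum_i scst U (u 0 i) * der (e i, 0) f.
Proof. by rewrite horizontal_expand der_dir_sum. Qed.

Fact D_ysm_subproof (u : 'rV[R]_n) i : der (0, u) (ysm i) = scst U (u 0 i).
Proof. exact: der_ysm. Qed.

Fact X_ysm_subproof (u : 'rV[R]_n) i : der (u, 0) (ysm i) = 0.
Proof. by rewrite der_ysm mxE. Qed.

Fact calculus_subproof : {c : fiber_calculus A n 'rV[R]_n |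
  [/\ forall u f, vder c u f = der (0, u) f, forall u f, hder c u f = der (u, 0) f,
      forall i, ed c i = e i, forall u i, cst_coord c u i = scst U (u 0 i) &
      forall i, yv c i = ysm i]}.
Proof.
by exists (FiberCalculus
  (fun u => der_is_derivation (0, u)) (fun u => der_is_derivation (u, 0))
  (fun u v => der_comm (0, u) (0, v)) (fun u v => der_comm (u, 0) (v, 0))
  (fun u v => der_comm (0, u) (v, 0))
  D_expand_subproof X_expand_subproof
  (fun u v i => der_scst _ _ _) (fun u v i => der_scst _ _ _)
  D_ysm_subproof X_ysm_subproof (@sfun_mulrn_inj R V U 1)).
Qed.

(* Opaque for the same reason as [der]. *)
Definition calculus := sval calculus_subproof.
Local Notation c := calculus.

Lemma vderE u f : vder c u f = der (0, u) f.
Proof. by rewrite /c; case: calculus_subproof => ? []. Qed.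
Lemma hderE u f : hder c u f = der (u, 0) f.
Proof. by rewrite /c; case: calculus_subproof => ? []. Qed.
Lemma edE i : ed c i = e i.
Proof. by rewrite /c; case: calculus_subproof => ? []. Qed.
Lemma cst_coordE u i : cst_coord c u i = scst U (u 0 i).
Proof. by rewrite /c; case: calculus_subproof => ? []. Qed.
Lemma yvE i : yv c i = ysm i.
Proof. by rewrite /c; case: calculus_subproof => ? []. Qed.

End Coordinates.
Arguments calculus {R n} U.

(** * Pointwise values of the abstract operators *)

Section Evaluation.
Context {R : realType} {n : nat} {U : opens ('rV[R]_n * 'rV[R]_n)%type}.
Local Notation c := (calculus U).
Local Notation D := (vder c).
Local Notation X := (hder c).
Local Notation e := (ed c).
Local Notation y := (yv c).
Implicit Types (f : smooth_fun U) (h : 'rV[R]_n * 'rV[R]_n -> R).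

Lemma cst_coord_evalE u i z : U z -> cst_coord c u i z = u 0 i.
Proof. by move=> Uz; rewrite cst_coordE scstE. Qed.

Lemma yv_evalE i z : U z -> y i z = z.2 0 i.
Proof. by move=> Uz; rewrite yvE ysmE. Qed.

Lemma dyE h f i z : (forall w, U w -> h w = f w) -> U z -> dy i h z = D (e i) f z.
Proof. by move=> hf Uz; rewrite vderE edE; exact: derive_sfun. Qed.

Lemma dxE h f i z : (forall w, U w -> h w = f w) -> U z -> dx i h z = X (e i) f z.
Proof. by move=> hf Uz; rewrite hderE edE; exact: derive_sfun. Qed.

Lemma vder_scst u a : D u (scst U a) = 0.
Proof. by rewrite vderE der_scst. Qed.

Lemma vder0 f : D 0 f = 0.
Proof. by rewrite vderE der_dir0. Qed.

Lemma vder_evalE u f z : U z -> D u f z = \sum_i u 0 i * D (e i) f z.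
Proof.
move=> Uz; rewrite D_expand eval_sum//; apply: eq_bigr => i _.
by rewrite evalM// cst_coord_evalE.
Qed.

Lemma vert_evalE W f z : U z -> vert c W f z = \sum_i W i z * D (e i) f z.
Proof.
move=> Uz; rewrite vertE eval_sum//; apply: eq_bigr => i _.
by rewrite evalM.
Qed.

Lemma horiz_evalE f z : U z -> horiz c f z = \sum_i z.2 0 i * X (e i) f z.
Proof.
move=> Uz; rewrite horizE eval_sum//; apply: eq_bigr => i _.
by rewrite evalM// yv_evalE.
Qed.

(* The factor k z.1 is constant along the fibre through z. *)
Lemma vder_fiber_scale (k : 'rV[R]_n -> R) f (q : smooth_fun U) u :
  (forall z, U z -> f z = k z.1 * q z) -> forall z, U z -> D u f z = k z.1 * D u q z.
Proof.
move=> fq z Uz.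
(* No regularity of [k] is available, so its value at [z] is frozen. Then [b] vanishes along the
   vertical line through [z], by [sfun_out] even where that line leaves [U]. *)
pose b := f - scst U (k z.1) * q.
have bline (h : R) : b (h *: (0, u) + z) = 0.
  have [Uh|] := pselect (U (h *: (0, u) + z)); last exact: sfun_out.
  by rewrite evalB// evalM// scstE// fq//= scaler0 add0r subrr.
have : D u b z = 0.
  rewrite vderE; apply: etrans (derE (0, u) b Uz) _; rewrite /derive.
  have -> : (fun h : R => h^-1 *: (b (h *: (0, u) + z) - b z)) = cst 0.
    apply/funext => h; rewrite bline.
    by have := bline 0; rewrite scale0r add0r => ->; rewrite subrr scaler0.
  exact: lim_cst.
have -> : D u b = D u f - scst U (k z.1) * D u q.
  rewrite /b (derivationD (D_derivation c u)) (derivationN (D_derivation c u)).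
  by rewrite (derivationM (D_derivation c u)) vder_scst mul0r add0r.
by rewrite evalB// evalM// scstE// => /eqP; rewrite subr_eq0 => /eqP.
Qed.

Lemma vder_linear a u v f : D (a *: u + v) f = scst U a * D u f + D v f.
Proof.
rewrite !vderE; apply: etrans _ (der_linear a (0, u) (0, v) f); congr (der _ f).
by congr (_, _); rewrite /= ?scaler0 ?addr0.
Qed.

Lemma vderD u v f : D (u + v) f = D u f + D v f.
Proof. by rewrite -[u in LHS]scale1r vder_linear scst1 mul1r. Qed.

End Evaluation.

(** * A Finsler metric in one chart *)

Section LocalMetric.
Context {R : realType} {n : nat} (L : 'rV[R]_n * 'rV[R]_n -> R).
Variable U : opens ('rV[R]_n * 'rV[R]_n)%type.
Hypothesis U_neq0 : forall z, U z -> z.2 != 0.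
Hypothesis U_fiber : forall x y y', U (x, y) -> y' != 0 -> U (x, y').
Hypothesis L_smooth : smooth_on U L.
Hypothesis L_homogeneous : forall x y (t : R), U (x, y) -> 0 < t -> L (x, t *: y) = t * L (x, y).
Hypothesis L_posdef : forall z, U z -> forall u, u != 0 -> 0 < inner L z u u.
Local Notation c := (calculus U).
Local Notation D := (vder c).
Local Notation X := (hder c).
Local Notation e := (ed c).
Local Notation y := (yv c).
Local Notation A := (smooth_fun U).

Definition length_fun : A := to_smooth ((smooth_onP U L).1 L_smooth).
Definition energy : A := scst U 2^-1 * (length_fun * length_fun).
Local Notation E := energy.

Lemma energyE z : U z -> L z ^+ 2 = (E *+ 2) z.
Proof.
move=> Uz; rewrite evalMn// !evalM// scstE// /length_fun to_smoothE// expr2.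
by field.
Qed.

Lemma gmxE i j z : U z -> gmx L z i j = D (e i) (D (e j) E) z.
Proof.
move=> Uz; rewrite mxE (@dyE _ _ _ _ (D (e j) (E *+ 2)))//; last first.
  by move=> w Uw; exact: (@dyE _ _ _ (L2 L) (E *+ 2) j w energyE Uw).
rewrite !(derivation_mulrn (D_derivation c _)) evalMn// -[X in _ * X]mulr_natl mulrA mulVf ?mul1r// pnatr_eq0.
Qed.

Lemma innerE u v z : U z -> inner L z u v = D u (D v E) z.
Proof.
move=> Uz; rewrite vder_evalE//; apply: eq_bigr => i _.
rewrite (D_comm c (e i)) vder_evalE// mulr_sumr; apply: eq_bigr => j _.
by rewrite gmxE// (D_comm c (e j)); ring.
Qed.

Lemma euler_energy : \sum_i y i * D (e i) E = E *+ 2.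
Proof.
apply: sfun_eq => z Uz.
have -> : (\sum_i y i * D (e i) E) z = D z.2 E z.
  rewrite vder_evalE// eval_sum//; apply: eq_bigr => i _; by rewrite evalM// yv_evalE.
(* In the direction y the difference quotient of [L] equals [L z] once h is nonzero and 1 + h > 0,
   the range where homogeneity applies. *)
have DL : D z.2 length_fun z = L z.
  rewrite vderE -(@derive_sfun _ _ _ _ L)//; last by move=> w Uw; rewrite to_smoothE.
  apply: (cvg_lim (@Rhausdorff R)).
  apply: (@cvg_trans _ ((fun=> L z) @ (0 : R)^')); last exact: cvg_cst.
  apply: near_eq_cvg; near=> h.
  have h1 : 0 < 1 + h.
    by rewrite -ltrBlDl sub0r; near: h; apply: nbhs_dnbhs; apply: lt_nbhsr; rewrite ltrN10.
  have h0 : h != 0 by near: h; exact: nbhs_dnbhs_neq.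
  rewrite /=. have -> : h *: (0, z.2) + z = (z.1, (1 + h) *: z.2).
    rewrite [in LHS](surjective_pairing z); congr (_, _); rewrite /= ?scaler0 ?add0r//.
    by rewrite scalerDl scale1r addrC.
  rewrite L_homogeneous// -?surjective_pairing//.
  by rewrite mulrDl mul1r addrAC subrr add0r /GRing.scale/= mulKf.
rewrite /E !(derivationM (D_derivation c _)) vder_scst.
rewrite mul0r add0r evalM// evalD// !evalM// DL scstE// evalMn// !evalM// scstE//.
by rewrite /length_fun to_smoothE//; ring.
Unshelve. all: by end_near. Qed.

Lemma inner_y u z : U z -> inner L z z.2 u = D u E z.
Proof.
move=> Uz; rewrite innerE// vder_evalE// -[in RHS](euler_D euler_energy) eval_sum//.
by apply: eq_bigr => i _; rewrite evalM// yv_evalE.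
Qed.

Lemma inner_yy z : U z -> inner L z z.2 z.2 = (E *+ 2) z.
Proof.
move=> Uz; rewrite inner_y// -euler_energy vder_evalE// eval_sum//.
by apply: eq_bigr => i _; rewrite evalM// yv_evalE.
Qed.

Lemma energy_gt0 z : U z -> 0 < E z.
Proof.
move=> Uz; have := L_posdef Uz (U_neq0 Uz); rewrite inner_yy// evalMn//.
by rewrite pmulrn_lgt0.
Qed.
Lemma gmx_unit z : U z -> gmx L z \in unitmx.
Proof.
move=> Uz; rewrite unitmxE unitfE; apply/det0P => -[u u0 ug].
have := L_posdef Uz u0; rewrite /inner.
rewrite exchange_big big1 ?ltxx// => j _; rewrite -mulr_suml.
have -> : \sum_i gmx L z i j * u 0 i = (u *m gmx L z) 0 j.
  by rewrite [RHS]mxE; apply: eq_bigr => i _; rewrite mulrC.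
by rewrite ug mxE mul0r.
Qed.

Definition metric_mx : 'M[A]_n := \matrix_(i, j) D (e i) (D (e j) E).

Lemma metric_mxE z (Uz : U z) : map_mx (eval_at Uz) metric_mx = gmx L z.
Proof. by apply/matrixP => i j; rewrite [RHS](gmxE i j Uz) mxE /metric_mx mxE. Qed.

Lemma det_metric_neq0 z : U z -> (\det metric_mx) z != 0.
Proof.
move=> Uz; rewrite -[_ z]/(eval_at Uz _) -det_map_mx metric_mxE -unitfE -unitmxE.
exact: gmx_unit.
Qed.

(** Cramer's formula gives an inverse whose entries are smooth by construction, unlike the pointwise
    [invmx]. *)
Definition inv_metric : 'M[A]_n := sinv det_metric_neq0 *: \adj metric_mx.

Lemma inv_metricE i l z : U z -> inv_metric i l z = invmx (gmx L z) i l.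
Proof.
move=> Uz; rewrite /invmx gmx_unit// [RHS]mxE.
have <- : (\adj metric_mx i l) z = \adj (gmx L z) i l.
  by rewrite -(metric_mxE Uz) -map_mx_adj [RHS]mxE.
have <- : (\det metric_mx) z = \det (gmx L z) by rewrite -(metric_mxE Uz) det_map_mx.
by rewrite [inv_metric i l]mxE evalM// sinvE.
Qed.

Lemma mul_metric_inv : metric_mx *m inv_metric = 1%:M.
Proof.
rewrite /inv_metric -scalemxAr mul_mx_adj scale_scalar_mx (_ : _ * _ = 1)//.
apply: sfun_eq => z Uz; rewrite evalM// sinvE// eval1// mulVf//.
exact: det_metric_neq0.
Qed.

Definition geodesic_form l := horiz c (D (e l) E) - X (e l) E.

Definition spray_coef i : A :=
  scst U 2^-1 * \sum_l inv_metric i l * geodesic_form l.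
Local Notation G := spray_coef.

Lemma scst_half (f : A) : (scst U 2^-1 * f) *+ 2 = f.
Proof.
by apply: sfun_eq => z Uz; rewrite evalMn// evalM// scstE//; field.
Qed.

Lemma geodesic_energy l :
  vert c G (D (e l) E) *+ 2 = horiz c (D (e l) E) - X (e l) E.
Proof.
have -> : vert c G (D (e l) E) = scst U 2^-1 * \sum_m geodesic_form m * (metric_mx *m inv_metric) l m.
  rewrite vertE [in RHS]mulr_sumr; under eq_bigr => i _ do rewrite /G -mulrA mulr_suml mulr_sumr.
  rewrite exchange_big; apply: eq_bigr => m _; rewrite [X in _ = _ * (_ * X)]mxE 2!mulr_sumr.
  by apply: eq_bigr => i _; rewrite [metric_mx _ _]mxE (D_comm c (e l)); ring.
rewrite scst_half mul_metric_inv (bigD1 l)//= big1 => [|m ml]; last first.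
  by rewrite mxE eq_sym (negPf ml) mulr0.
by rewrite mxE eqxx mulr1 addr0.
Qed.

Lemma sprayE i z : U z -> spray L i z = G i z.
Proof.
move=> Uz; rewrite /G evalM// scstE// eval_sum// /spray.
(* One factor 1/2 belongs to [spray_coef], the other is absorbed by F^2 = 2E. *)
have -> : (4^-1 : R) = 2^-1 * 2^-1 by field.
rewrite -mulrA; congr (_ * _); rewrite mulr_sumr; apply: eq_bigr => l _.
rewrite evalM// inv_metricE// mulrCA; congr (_ * _).
have dyL2 w : U w -> dy l (L2 L) w = D (e l) (E *+ 2) w by exact: (@dyE _ _ _ (L2 L) (E *+ 2) l w energyE).
rewrite (@dxE _ _ _ (L2 L) (E *+ 2) l z energyE Uz) evalB// horiz_evalE//.
under eq_bigr => k _ do rewrite (@dxE _ _ _ _ _ k z dyL2 Uz) (derivation_mulrn (D_derivation c _))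
   (derivation_mulrn (X_derivation c _)) evalMn// mulrnAl mulrC.
rewrite (derivation_mulrn (X_derivation c _)) evalMn// sumrMnl -mulrnBl.
by rewrite -[X in _ * X]mulr_natl mulrA mulVf ?mul1r// pnatr_eq0.
Qed.

Lemma dy_sprayE i j z : U z -> dy j (spray L i) z = D (e j) (G i) z.
Proof. exact: (@dyE _ _ _ (spray L i) (G i) j z (@sprayE i)). Qed.

Lemma dydy_sprayE i j k z : U z ->
  dy j (dy k (spray L i)) z = D (e j) (D (e k) (G i)) z.
Proof. exact: (@dyE _ _ _ _ _ j z (@dy_sprayE i k)). Qed.

Lemma berwaldE i j k l z : U z ->
  berwald L i j k l z = D (e j) (D (e k) (D (e l) (G i))) z.
Proof. exact: (@dyE _ _ _ _ _ j z (@dydy_sprayE i k l)). Qed.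

Lemma spray_der_evalE f z : U z -> spray_der c G f z =
  \sum_k z.2 0 k * X (e k) f z - 2 * \sum_k G k z * D (e k) f z.
Proof.
by move=> Uz; rewrite SE evalB// horiz_evalE// evalMn// vert_evalE// mulr_natl.
Qed.

Lemma riemannE i k z : U z -> riemann L i k z = riem c G (e k) i z.
Proof.
move=> Uz; rewrite /riem evalB// evalB// spray_der_evalE// evalMn// vert_evalE//.
have aux (a b d q : R) : 2 * a - b + 2 * d - q = a *+ 2 - (b - 2 * d) - q by ring.
apply: etrans _ (aux _ _ _ _).
congr (2 * _ - _ + 2 * _ - _).
- exact: (@dxE _ _ _ (spray L i) (G i) k z (@sprayE i) Uz).
- apply: eq_bigr => j _; congr (_ * _).
  exact: (@dxE _ _ _ (dy k (spray L i)) (D (e k) (G i)) j z (@dy_sprayE i k) Uz).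
- by apply: eq_bigr => j _; rewrite (sprayE j Uz) (dydy_sprayE i j k Uz).
- by apply: eq_bigr => j _; rewrite (dy_sprayE i j Uz) (dy_sprayE j k Uz) mulrC.
Qed.

Local Notation angular := (angular c E).

Lemma angularD u v w : angular (u + v) w = angular u w + angular v w.
Proof. by rewrite /angular !vderD; ring. Qed.

Lemma angular_expand u v z : U z -> angular u v z = \sum_i u 0 i * angular (e i) v z.
Proof.
move=> Uz; rewrite /angular evalB// !evalM// [D u _ z]vder_evalE// [D u E z]vder_evalE//.
rewrite mulr_sumr mulr_suml -sumrB; apply: eq_bigr => i _.
by rewrite evalB// !evalM//; ring.
Qed.

Lemma angularE u v z : U z ->
  angular u v z = inner L z z.2 z.2 * inner L z u v - inner L z z.2 u * inner L z z.2 v.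
Proof. by move=> Uz; rewrite inner_yy// !inner_y// innerE// evalB// !evalM. Qed.

Lemma angular_gt0 u z : U z -> free [:: z.2; u] -> 0 < angular u u z.
Proof.
move=> Uz yu; pose a := inner L z z.2 z.2; pose b := inner L z z.2 u.
have a0 : 0 < a by apply: L_posdef => //; exact: U_neq0.
(* The component of [u] orthogonal to y, multiplied by a = g(y, y) to avoid a division; g(w, w) is
   [a] times the angular form, as in the proof of Cauchy-Schwarz. *)
pose w := a *: u + (- b) *: z.2.
have w0 : w != 0.
  apply/eqP => wE; move/(free2P _ (U_neq0 Uz)): yu => /(_ (a^-1 * b)); apply.
  apply: (scalerI (lt0r_neq0 a0)); rewrite scalerA mulrA mulfV ?lt0r_neq0// mul1r.
  by apply/eqP; rewrite -subr_eq0 -scaleNr; apply/eqP.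
have lin p f : D w (D p f) z = a * D u (D p f) z - b * D z.2 (D p f) z.
  rewrite /w vder_linear -[_ *: z.2]addr0 vder_linear vder0.
  by rewrite !(evalD, evalM, scstE)// ?eval0; ring.
have := L_posdef Uz w0; rewrite innerE// lin !(D_comm c _ w) !lin -!innerE//.
rewrite -/a [inner L z u z.2]innerE// (D_comm c u) -innerE// -/b angularE// -/a -/b.
rewrite (_ : _ - _ = a * (a * inner L z u u - b * b)); last by ring.
by rewrite pmulr_rgt0.
Qed.

(** * Isotropic flag curvature determines the Riemann curvature *)

Section IsotropicCurvature.
Hypothesis n1 : (1 < n)%N.
Variable k : 'rV[R]_n -> R.
Hypothesis flag : forall z u, U z -> free [:: z.2; u] -> flag_curvature L z u = k z.1.

Lemma riem_evalE u i z : U z -> riem c G u i z = \sum_j riemann L i j z * u 0 j.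
Proof.
move=> Uz; rewrite riem_expand eval_sum//; apply: eq_bigr => j _.
by rewrite evalM// cst_coord_evalE// (riemannE i j Uz) mulrC.
Qed.

Lemma inner_riemann u v z : U z ->
  inner L z v (riemann_op L z u) = riem_form c G E u v z.
Proof.
move=> Uz; rewrite /inner exchange_big /riem_form eval_sum//; apply: eq_bigr => j _.
rewrite evalM// riem_evalE// mxE -mulr_suml mulrC; congr (_ * _).
rewrite (D_comm c (e j)) vder_evalE//; apply: eq_bigr => i _.
by rewrite (gmxE i j Uz) mulrC.
Qed.

Lemma riem_formD u v w : riem_form c G E (u + v) w = riem_form c G E u w + riem_form c G E v w.
Proof.
rewrite /riem_form -big_split; apply: eq_bigr => i _ /=; rewrite -mulrDl; congr (_ * _).
rewrite !(riem_expand c G (_ : 'rV_n)) -big_split; apply: eq_bigr => j _ /=.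
by rewrite -mulrDl !cst_coordE mxE scstD.
Qed.

(** On the diagonal, for [u] independent of y, this is the definition of flag curvature; both sides
    are symmetric and bilinear, so polarization gives the rest. *)
Lemma riem_form_isotropic u v z : U z -> riem_form c G E u v z = k z.1 * angular u v z.
Proof.
move=> Uz; apply/eqP; rewrite -subr_eq0; apply/eqP.
pose B a b := riem_form c G E a b z - k z.1 * angular a b z.
rewrite -/(B u v); apply: (quadratic_free2_eq0 n1 (U_neq0 Uz)) => [a b d|a b|a ya].
- by rewrite /B riem_formD angularD (evalD _ _ Uz) (evalD _ _ Uz); ring.
- by rewrite /B (riem_form_sym euler_energy geodesic_energy) (angularC _ _ a).
- have a0 := angular_gt0 Uz ya; rewrite /B -(flag Uz ya) /flag_curvature.
  by rewrite expr2 -angularE// inner_riemann// mulfVK ?subrr// lt0r_neq0.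
Qed.

Lemma riem_isotropic u i z : U z ->
  riem c G u i z = k z.1 * (E *+ 2 * cst_coord c u i - y i * D u E) z.
Proof.
move=> Uz; pose q j : A := E *+ 2 * cst_coord c u j - y j * D u E.
(* The defect of the identity, frozen at [z]. Using it as second argument of [riem_form_isotropic]
   gives g(w, w) = 0, and g is definite. *)
pose w : 'rV[R]_n := \row_j (riem c G u j z - k z.1 * q j z).
suff w0 : w = 0.
  by have := congr1 (fun x : 'rV[R]_n => x 0 i) w0; rewrite !mxE => /eqP; rewrite subr_eq0 => /eqP.
apply/eqP; apply: contraT => /(L_posdef Uz); rewrite innerE// vder_evalE//.
suff -> : \sum_j w 0 j * D (e j) (D w E) z =
    riem_form c G E u w z - k z.1 * angular u w z.
  by rewrite riem_form_isotropic// subrr ltxx.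
have -> : angular u w = \sum_j q j * D (e j) (D w E).
  rewrite /angular (D_expand c u) -[D w E in X in _ - _ * X](euler_D euler_energy).
  by rewrite !mulr_sumr -sumrB; apply: eq_bigr => j _; rewrite /q; ring.
rewrite /riem_form !eval_sum// mulr_sumr -sumrB; apply: eq_bigr => j _.
by rewrite mxE !evalM//; ring.
Qed.

Lemma DD_riem_isotropic u z : U z ->
  (\sum_i D (e i) E * D u (D u (riem c G u i))) z =
  - (k z.1 * ((E *+ 2) z * D u (D u (D u E)) z)).
Proof.
move=> Uz.
have DDriem i : D u (D u (riem c G u i)) z = k z.1 * (- (y i * D u (D u (D u E)))) z.
  pose q : A := E *+ 2 * cst_coord c u i - y i * D u E.
  have -> : - (y i * D u (D u (D u E))) = D u (D u q).
    by rewrite /q DD_isotropic.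
  apply: (vder_fiber_scale (q := D u q)) => // w Uw.
  by apply: (vder_fiber_scale (q := q)) => // x Ux; exact: riem_isotropic.
rewrite -euler_energy !eval_sum// mulr_suml mulr_sumr -sumrN.
apply: eq_bigr => i _; rewrite evalM// DDriem evalN// !evalM//; ring.
Qed.

End IsotropicCurvature.

Lemma vert_y_spray i : vert c y (G i) = G i *+ 2.
Proof.
apply: sfun_eq => z Uz; pose w : 'rV[R]_n := \row_j (vert c y (G j) z - (G j *+ 2) z).
suff w0 : w = 0.
  by have := congr1 (fun x : 'rV[R]_n => x 0 i) w0; rewrite !mxE => /eqP; rewrite subr_eq0 => /eqP.
suff wg : w *m gmx L z = 0 by rewrite -[w](mulmxK (gmx_unit Uz)) wg mul0mx.
apply/rowP => l; rewrite [RHS]mxE mxE.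
have := congr1 (fun f : A => f z) (vert_y_G euler_energy geodesic_energy l).
rewrite evalMn// !vert_evalE// => /eqP; rewrite -subr_eq0 => /eqP E0; apply: etrans _ E0.
rewrite -sumrMnl -sumrB; apply: eq_bigr => j _.
by rewrite (gmxE j l Uz) mxE evalMn//=; ring.
Qed.

Lemma y_lowE i z : U z -> y_low L i z = D (e i) E z.
Proof.
move=> Uz; rewrite /y_low -(euler_D euler_energy) eval_sum//; apply: eq_bigr => j _.
by rewrite (gmxE i j Uz) (D_comm c (e i)) evalM// yv_evalE// mulrC.
Qed.

Lemma sqr_L_neq0 z : U z -> L z ^+ 2 != 0.
Proof.
by move=> Uz; rewrite energyE// evalMn// mulrn_eq0 lt0r_neq0// energy_gt0.
Qed.

Lemma h_lowE i j z : U z -> L z ^+ 2 * h_low L i j z = angular (e i) (e j) z.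
Proof.
move=> Uz; rewrite /h_low mulrBr !mulrA mulfV ?sqr_L_neq0// mul1r.
by rewrite !y_lowE// (gmxE i j Uz) /angular evalB// !evalM// energyE.
Qed.

Lemma h_mix_y_low j z : U z -> \sum_i D (e i) E z * h_mix L i j z = 0.
Proof.
move=> Uz; under eq_bigr => i _ do rewrite /h_mix mulrBr.
rewrite sumrB (bigD1 j)//= eqxx mulr1 big1 ?addr0 => [|i /negPf ij]; last first.
  by rewrite ij mulr0.
have -> : \sum_i D (e i) E z * (L z ^- 2 * yc i z * y_low L j z) =
    (L z ^- 2 * y_low L j z) * \sum_i (y i * D (e i) E) z.
  rewrite mulr_sumr; apply: eq_bigr => i _.
  by rewrite evalM// yv_evalE// /yc; ring.
by rewrite -eval_sum// euler_energy -energyE// mulrAC mulVf ?sqr_L_neq0// mul1r y_lowE// subrr.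
Qed.

Lemma cartan_eq0_polarize : (forall u, D u (D u (D u E)) = 0) ->
  forall u v w, D u (D v (D w E)) = 0.
Proof.
move=> C0; apply: (@cubic_polarization _ _ (fun u v w => D u (D v (D w E)))) => //.
- exact: sfun_mulrn_inj.
- by move=> u v w x; rewrite vderD.
- by move=> u v w; rewrite (D_comm c u).
- by move=> u v w; rewrite (D_comm c v).
Qed.

Lemma cartan_of_riemannian :
  (forall x y y', U (x, y) -> U (x, y') -> gmx L (x, y) = gmx L (x, y')) ->
  forall u v w, D u (D v (D w E)) = 0.
Proof.
move=> gx u v w; apply: sfun_eq => z Uz; rewrite eval0.
(* Evaluating g at the fixed fibre vector z.2 writes it as a function of x alone times the ring
   unit, the shape that [vder_fiber_scale] differentiates. *)
have gz x : U x -> D v (D w E) x = inner L (x.1, z.2) v w * (1 : A) x.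
  case: x => x p Ux; rewrite (eval1 Ux) mulr1 -(innerE v w Ux).
  apply: eq_bigr => i _; apply: eq_bigr => j _.
  by rewrite (gx _ _ z.2 Ux)//=; apply: U_fiber Ux _; exact: U_neq0.
rewrite (vder_fiber_scale (k := fun x => inner L (x, z.2) v w) u gz Uz).
by rewrite -scst1 vder_scst eval0 mulr0.
Qed.

(** The slit fibre is not convex. The line through two independent vectors avoids the origin, so
    g_ij is constant along it; dependent vectors are compared through a third one. *)
Lemma riemannian_of_cartan : (1 < n)%N -> (forall u v w, D u (D v (D w E)) = 0) ->
  forall x y y', U (x, y) -> U (x, y') -> gmx L (x, y) = gmx L (x, y').
Proof.
move=> n1 C0 x p q Up Uq; apply/matrixP => i j.
apply: etrans (gmxE i j Up) (etrans _ (esym (gmxE i j Uq))).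
set f := D (e i) (D (e j) E).
have line a b : U (x, a) -> free [:: a; b] -> f (x, a) = f (x, b).
  move=> Ua ab; have a0 : a != 0 := U_neq0 Ua.
  pose l (t : R) := (x, a) + t *: (0, b - a) : 'rV[R]_n * 'rV[R]_n.
  have Ul (t : R) : U (l t).
    have -> : l t = (x, a + t *: (b - a)) by congr (_, _); rewrite /= scaler0 addr0.
    apply: U_fiber Ua _; apply/eqP => lt0.
    have [t0|t0] := eqVneq t 0.
      by move: lt0; rewrite t0 scale0r addr0; exact/eqP.
    (* If a + t (b - a) = 0 with t nonzero, then b = (1 - t^-1) a. *)
    move/(free2P _ a0): ab => /(_ (1 - t^-1)); apply.
    apply: (scalerI t0); rewrite scalerA mulrBr mulr1 mulfV// scalerBl scale1r.
    apply/eqP; rewrite -subr_eq0 opprB addrA addrAC -scalerBr addrC.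
    by rewrite lt0.
  have dl (t : R) : is_derive t (1 : R) (fun r => f (l r)) (0 : R).
    have d := @is_derive_line _ _ f (x, a) (0, b - a) t (sfun_derivable (Ul t)).
    rewrite (_ : 0 = 'D_(0, b - a) f ((x, a) + t *: (0, b - a)))//.
    by rewrite -(derE (0, b - a) f (Ul t)) -vderE C0 eval0.
  have := @is_derive_0_is_cst _ (fun r => f (l r)) 0 1 dl; rewrite /= /l scale0r addr0 scale1r => ->.
  by congr (f _); congr (_, _); rewrite /= ?addr0// addrC subrK.
have [pq|pq] := boolP (free [:: p; q]); first exact: line.
have [w qw] := exists_free2 n1 (U_neq0 Uq).
have pw : free [:: p; w].
  apply/(free2P _ (U_neq0 Up)) => a wE; apply: (negP pq); apply/(free2P _ (U_neq0 Up)) => b qE.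
  have b0 : b != 0 by apply: contraTneq (U_neq0 Uq) => b0; rewrite /= qE b0 scale0r eqxx.
  move/(free2P _ (U_neq0 Uq)): qw => /(_ (a / b)); apply.
  by rewrite wE /= qE scalerA mulfVK.
by rewrite (line p w)// (line q w).
Qed.

(** * Consequences of the assumed Berwald curvature *)

Section BerwaldForm.
Hypothesis n1 : (1 < n)%N.
Variables (m : 'I_n -> 'rV[R]_n * 'rV[R]_n -> R) (lam : 'rV[R]_n * 'rV[R]_n -> R).
Hypothesis berwald_form : forall z, U z -> forall i j k l,
  berwald L i j k l z =
    (m j z * h_low L k l z + m k z * h_low L j l z + m l z * h_low L j k z) * yc i z
    + lam z * (h_mix L i j z * h_low L k l z + h_mix L i k z * h_low L j l z
               + h_mix L i l z * h_low L j k z).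
Local Notation landsberg_form := (landsberg_form c G E).

Definition mu_at (u : 'rV[R]_n) z := \sum_i u 0 i * m i z.

Lemma mu_at_ed l z : mu_at (e l) z = m l z.
Proof.
rewrite edE /mu_at (bigD1 l)//= big1 ?addr0 => [|j jl]; first by rewrite mxE !eqxx mul1r.
by rewrite mxE (negPf jl) andbF mul0r.
Qed.

(** Contraction with y_i = d_i E kills the [lam] part, since y_i h^i_j = 0, and turns y^i into F^2,
    which converts [h_low] into [angular]. *)
Lemma landsberg_basis j k l z : U z -> landsberg_form (e j) (e k) (e l) z =
  m j z * angular (e k) (e l) z + m k z * angular (e j) (e l) z + m l z * angular (e j) (e k) z.
Proof.
move=> Uz; rewrite vert_evalE// -!h_lowE// energyE// -euler_energy eval_sum//.
pose a := m j z * h_low L k l z + m k z * h_low L j l z + m l z * h_low L j k z.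
transitivity (a * (\sum_i (y i * D (e i) E) z) +
    lam z * h_low L k l z * (\sum_i D (e i) E z * h_mix L i j z) +
    lam z * h_low L j l z * (\sum_i D (e i) E z * h_mix L i k z) +
    lam z * h_low L j k z * (\sum_i D (e i) E z * h_mix L i l z)).
  rewrite !mulr_sumr -!big_split; apply: eq_bigr => i _ /=.
  by rewrite -(berwaldE i j k l Uz) berwald_form// evalM// yv_evalE// /a /yc; ring.
by rewrite !h_mix_y_low// /a; ring.
Qed.

Lemma landsbergE u v w z : U z -> landsberg_form u v w z =
  mu_at u z * angular v w z + mu_at v z * angular u w z + mu_at w z * angular u v z.
Proof.
move=> Uz; pose T2 u v w :=
  mu_at u z * angular v w z + mu_at v z * angular u w z + mu_at w z * angular u v z.
rewrite -/(T2 u v w).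
apply: (@trilinear_ext _ _ (fun u v w => landsberg_form u v w z) T2)
  => {u v w} [u v w|u v w|u v w|u v w|u v w|u v w|i j k].
- rewrite landsberg_form_expand eval_sum//; apply: eq_bigr => i _.
  by rewrite evalM// cst_coord_evalE// edE.
- rewrite /T2 (angular_expand u v Uz) (angular_expand u w Uz) {1}/mu_at.
  rewrite mulr_suml !mulr_sumr -!big_split; apply: eq_bigr => i _ /=.
  by rewrite -(edE U) mu_at_ed; ring.
- by rewrite landsberg_formC.
- by rewrite landsberg_formA.
- by rewrite /T2 (angularC _ _ v u); ring.
- by rewrite /T2 (angularC _ _ w v); ring.
- by rewrite -!(edE U) landsberg_basis// /T2 !mu_at_ed.
Qed.

(** Write T for [landsberg_form]. By [landsbergE], T(e_i, w, w) = mu_i H + 2 mu(w) B and T(w, w, w)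
    = 3 mu(w) H. Eliminating mu(w) gives 3 H^2 mu_i = 3 H T(e_i, w, w) - 2 B T(w, w, w), that is
    mu_i = N / Q near [z]; H is positive at [z] because [w] is independent of y there. *)
Lemma mu_differentiable i z : U z -> differentiable (m i) z.
Proof.
move=> Uz; have [w yw] := exists_free2 n1 (U_neq0 Uz).
pose H := angular w w; pose B := angular (e i) w.
pose N : A := H * landsberg_form (e i) w w *+ 3 - landsberg_form w w w * B *+ 2.
pose Q : A := H * H *+ 3.
have H0 : H z != 0 by rewrite lt0r_neq0// angular_gt0.
have Q0 : Q z != 0 by rewrite evalMn// evalM// mulrn_eq0 mulf_eq0 (negPf H0).
apply: (@near_eq_differentiable _ _ _ ((N : _ -> R) * (fun x => (Q x)^-1))); last first.
  apply: differentiableM; first exact: sfun_differentiable.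
  apply: differentiableV => //; exact: sfun_differentiable.
have nQ : \forall x \near z, Q x != 0.
  have cQ : {for z, continuous Q} by apply: differentiable_continuous; exact: sfun_differentiable.
  exact: (cvgr_neq0 _ cQ Q0).
apply: filterS2 (near_in (opensP U) Uz) nQ => x Ux Qx; rewrite fctE.
apply: (canLR (mulfK Qx)).
rewrite /N /Q evalB// !evalMn// !evalM// (landsbergE (e i) _ _ Ux) (landsbergE w _ _ Ux).
by rewrite mu_at_ed -/H -/B; ring.
Qed.

(** As a derivative along the single vector (y, -2G), the spray can also be applied to [m], which is
    not an element of the ring. *)
Lemma spray_der_dirE f z : U z ->
  spray_der c G f z = 'D_(z.2, \row_r (-2 * G r z)) f z.
Proof.
move=> Uz; rewrite spray_der_evalE// derive_pair; last exact: sfun_differentiable.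
congr (_ + _).
  by apply: eq_bigr => i _; rewrite (@dxE _ _ _ f f i z (fun _ _ => erefl) Uz).
rewrite -mulNr mulr_sumr; apply: eq_bigr => i _.
by rewrite (@dyE _ _ _ f f i z (fun _ _ => erefl) Uz) mxE mulrA.
Qed.

(** Homogeneity of G gives y^j d_j G^r = 2 G^r, which completes the spray direction, and y^j d_i d_j
    G^r = d_i G^r. The result is the dynamical derivative of mu. *)
Lemma hcov_dir i z : U z -> \sum_j hcov L m i j z * yc j z =
  'D_(z.2, \row_r (-2 * G r z)) (m i) z - \sum_r D (e i) (G r) z * m r z.
Proof.
move=> Uz; rewrite derive_pair; last exact: mu_differentiable.
have yG r : \sum_j z.2 0 j * dy j (spray L r) z = 2 * G r z.
  rewrite mulr_natl -evalMn// -vert_y_spray vert_evalE//; apply: eq_bigr => j _.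
  by rewrite yv_evalE// (dy_sprayE r j Uz).
have yDG r : \sum_j z.2 0 j * dy i (dy j (spray L r)) z = D (e i) (G r) z.
  transitivity (vert c y (D (e i) (G r)) z).
    rewrite vert_evalE//; apply: eq_bigr => j _.
    by rewrite yv_evalE// (dydy_sprayE r i j Uz) (D_comm c (e i)).
  rewrite vert_y_D vert_y_spray (derivation_mulrn (D_derivation c _)) evalB// evalMn//.
  by ring.
rewrite /hcov; under eq_bigr => j _ do rewrite /yc mulrC !mulrBr.
rewrite !sumrB; congr (_ + _ - _).
  rewrite -sumrN; under eq_bigr => j _ do rewrite mulr_sumr -sumrN.
  rewrite exchange_big; apply: eq_bigr => r _.
  rewrite mxE mulNr -yG mulNr mulr_suml -sumrN; apply: eq_bigr => j _.
  by rewrite mulrA.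
under eq_bigr => j _ do rewrite mulr_sumr.
rewrite exchange_big; apply: eq_bigr => r _; rewrite -yDG mulr_suml.
by apply: eq_bigr => j _; rewrite mulrA.
Qed.

Lemma derive_mu_at u z v : U z -> 'D_v (mu_at u) z = \sum_i u 0 i * 'D_v (m i) z.
Proof.
move=> Uz; have -> : mu_at u = \sum_(i < n) (u 0 i *: m i).
  by apply/funext => x; rewrite fct_sumE.
have dm i : derivable (m i) z v by apply: diff_derivable; exact: mu_differentiable.
rewrite derive_sum => [|i]; last exact: derivableZ.
by apply: eq_bigr => i _; rewrite deriveZ.
Qed.

Lemma mu_at_differentiable u z : U z -> differentiable (mu_at u) z.
Proof.
move=> Uz; have -> : mu_at u = \sum_(i < n) (u 0 i *: m i).
  by apply/funext => x; rewrite fct_sumE.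
by apply: differentiable_sum => i; apply: differentiableZ; exact: mu_differentiable.
Qed.

Lemma spray_der_landsberg u z : U z -> spray_der c G (landsberg_form u u u) z =
  'D_(z.2, \row_r (-2 * G r z)) (mu_at u) z * angular u u z *+ 3 +
  mu_at u z * spray_der c G (angular u u) z *+ 3.
Proof.
move=> Uz; rewrite !spray_der_dirE//; set v := (_, _).
have du : derivable (mu_at u) z v by apply: diff_derivable; exact: mu_at_differentiable.
have da : derivable (angular u u) z v by exact: sfun_derivable.
rewrite (derive_eq_in (opensP U) (g := 3 *: (mu_at u * (angular u u : _ -> R))))//; last first.
  move=> x Ux; rewrite (landsbergE u u u Ux); rewrite !fctE /GRing.scale/=; ring.
apply: etrans (deriveZ 3 (derivableM du da)) _.
rewrite (deriveM du da).
have scale3 (p q r s : R) : 3 * (p * q + r * s) = s * r *+ 3 + p * q *+ 3 by ring.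
exact: scale3.
Qed.

Lemma cartan_eq0 u z (k : 'rV[R]_n -> R) :
  (forall z u, U z -> free [:: z.2; u] -> flag_curvature L z u = k z.1) ->
  U z -> k z.1 != 0 ->
  (forall i, \sum_j hcov L m i j z * yc j z = 0) -> D u (D u (D u E)) z = 0.
Proof.
move=> flag Uz kz hc.
have dm i : 'D_(z.2, \row_r (-2 * G r z)) (m i) z = \sum_r D (e i) (G r) z * m r z.
  by apply/eqP; rewrite -subr_eq0 -hcov_dir// hc.
have dmu : 'D_(z.2, \row_r (-2 * G r z)) (mu_at u) z = \sum_r D u (G r) z * m r z.
  rewrite derive_mu_at//; under eq_bigr => i _ do rewrite dm mulr_sumr.
  rewrite exchange_big; apply: eq_bigr => r _; rewrite (vder_evalE u _ Uz) mulr_suml.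
  by apply: eq_bigr => i _; rewrite mulrA.
have := riem_landsberg euler_energy geodesic_energy u.
move=> /(congr1 (fun f : A => f z)); rewrite (DD_riem_isotropic n1 flag)//.
rewrite vert_landsberg (evalD (- _) _ Uz) evalN// !evalMn// eval_sum//.
rewrite -[landsberg _ _ _ _]/(landsberg_form u u u) spray_der_landsberg// dmu.
rewrite (S_angular euler_energy geodesic_energy) evalMn// eval_sum//.
have -> : \sum_r (D u (G r) * landsberg_form (e r) u u) z =
    (\sum_r D u (G r) z * m r z) * angular u u z +
    mu_at u z * (\sum_r (D u (G r) * angular (e r) u) z) *+ 2.
  rewrite mulr_suml mulr_sumr -sumrMnl -big_split; apply: eq_bigr => r _ /=.
  by rewrite !evalM// (landsbergE _ _ _ Uz) mu_at_ed; ring.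
(* With S mu(u) = mu(N u) and S H(u, u) = 2 H(N u, u), the derivative of T = 3 mu(u) H(u, u) equals
   3 T(N u, u, u), so only the curvature term remains. *)
move=> kE; have {kE} : k z.1 * (E z *+ 2 * D u (D u (D u E)) z) = 0.
  by apply: oppr_inj; rewrite kE; ring.
move/eqP; rewrite !mulf_eq0 (negPf kz) -evalMn// -energyE// (negPf (sqr_L_neq0 Uz)).
by move/eqP.
Qed.

Lemma mu_eq0 i z : (forall u v w, D u (D v (D w E)) = 0) -> U z -> m i z = 0.
Proof.
move=> cartan0 Uz; rewrite -mu_at_ed.
apply: (additive_free2_eq0 n1 (U_neq0 Uz) (phi := mu_at ^~ z)) => [u v|u yu].
  by rewrite /mu_at -big_split; apply: eq_bigr => j _; rewrite mxE mulrDl.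
have := S_DDDE euler_energy geodesic_energy u.
rewrite cartan0 (derivation0 (S_derivation c G)) vertE big1 => [|j _]; last first.
  by rewrite cartan0 mulr0.
rewrite mul0rn sub0r => /(congr1 (fun f : A => f z)); rewrite evalN// eval0.
rewrite -[landsberg _ _ _ _]/(landsberg_form u u u) (landsbergE u u u Uz) => E0.
have : mu_at u z * angular u u z *+ 3 = 0 by apply: oppr_inj; rewrite oppr0 [RHS]E0; ring.
move/eqP; rewrite mulrn_eq0 mulf_eq0 (gt_eqF (angular_gt0 Uz yu)) orbF.
by move/eqP.
Qed.

Lemma riemannian_iff_const_mu (k : 'rV[R]_n -> R) :
  (forall z u, U z -> free [:: z.2; u] -> flag_curvature L z u = k z.1) ->
  (forall z, U z -> k z.1 != 0) ->
  (forall x y y', U (x, y) -> U (x, y') -> gmx L (x, y) = gmx L (x, y')) <->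
  (forall z, U z -> forall i, \sum_j hcov L m i j z * yc j z = 0).
Proof.
move=> flag k0; split=> [gx z Uz i|hc].
  have C0 := cartan_of_riemannian gx.
  rewrite hcov_dir// big1 ?subr0 => [|r _]; last by rewrite (mu_eq0 r C0 Uz) mulr0.
  rewrite (derive_eq_in (opensP U) (g := cst 0))//; first exact: derive_cst.
  by move=> x Ux; exact: mu_eq0.
apply: riemannian_of_cartan => //; apply: cartan_eq0_polarize => u.
apply: sfun_eq => z Uz; rewrite eval0.
exact: cartan_eq0 flag Uz (k0 _ Uz) (hc _ Uz).
Qed.

End BerwaldForm.

End LocalMetric.

(** * From charts to the manifold *)

Section Charts.
Context {R : realType} {n : nat} {M : manifold R n}.

Lemma slit_open (a : chart M) : open (slit a).
Proof.
have -> : slit a = (fst @^-1` Defs.codom a) `&` (snd @^-1` [set v : 'rV[R]_n | v != 0]).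
  by apply/seteqP; split=> z.
apply: openI; apply: open_comp => [z _|]; [exact: cvg_fst|exact: codom_open|exact: cvg_snd|].
rewrite (_ : [set v | v != 0] = ~` [set (0 : 'rV[R]_n)]); last first.
  by apply/seteqP; split=> v /= /eqP.
apply: closed_openC; apply: accessible_closed_set1.
by apply: hausdorff_accessible; exact: norm_hausdorff.
Qed.

Definition slit_opens (a : chart M) := Opens (@slit_open a).

End Charts.

Theorem theorem2 (R : realType) (n : nat) (M : manifold R n)
    (F : tangent_bundle M -> R) (K : M -> R)
    (mu : chart M -> tangent_bundle M -> 'rV[R]_n)
    (lambda : tangent_bundle M -> R) :
  (1 < n)%N ->
  finsler_metric F ->
  isotropic_flag_curvature F K ->
  (forall p : M, K p <> 0) ->
  covector_field mu ->
  (forall (a : chart M) (v : tangent_bundle M) (t : R),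
    nonzero v -> dom a (base v) -> 0 < t ->
    mu a (tscale t v) = t ^- 2 *: mu a v) ->
  (forall (v : tangent_bundle M) (t : R),
    nonzero v -> 0 < t -> lambda (tscale t v) = t^-1 * lambda v) ->
  (forall (a : chart M) (z : 'rV[R]_n * 'rV[R]_n), slit a z ->
    let L := local_rep F a in
    let m := local_cov mu a in
    forall i j k l : 'I_n,
      berwald L i j k l z =
        (m j z * h_low L k l z + m k z * h_low L j l z + m l z * h_low L j k z)
          * yc i z
        + local_rep lambda a z
          * (h_mix L i j z * h_low L k l z + h_mix L i k z * h_low L j l z
             + h_mix L i l z * h_low L j k z)) ->
  (riemannian F <-> constant_along_geodesics F mu).
Proof.
move=> n1 [_ F_smooth F_hom F_pos] flag K0 _ _ _ berw.
(* Both properties are conjunctions over the charts, so the equivalence may be proved in each chart,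
   where [K] is read as [K \o psi a]. *)
suff chartwise (a : chart M) :
    (forall x y y', slit a (x, y) -> slit a (x, y') ->
      gmx (local_rep F a) (x, y) = gmx (local_rep F a) (x, y')) <->
    (forall z, slit a z -> forall i,
      \sum_j hcov (local_rep F a) (local_cov mu a) i j z * yc j z = 0).
  by split=> H a; apply/chartwise; exact: H.
apply: (@riemannian_iff_const_mu R n (local_rep F a) (slit_opens a)
  _ _ (F_smooth a) _ (F_pos a) n1 (local_cov mu a) (local_rep lambda a) (berw a)
  (K \o psi a)).
- by move=> z [].
- by move=> x y y' [/= ax _] y'0; split.
- by move=> x y t _ t0; rewrite /local_rep /= -(tscale_tvec t a (x, y)) F_hom.
- exact: flag.
- by move=> z _; apply/eqP/K0.
Qed.
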